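(* Suppose that either $V_h$ is the space of continuous piecewise linear polynomials, or $\alpha=0$ (and set $p=1$ in the definitions of $B_h$ and of the energy norm). Then for all sufficiently small $\theta>0$ there exists a constant $C>0$, independent of $h$, such that for all $v\in V_h$ $$B_h(v,v)\ \ge\ C\,|||v|||^2 .$$
   Context: Let $\Omega_s\subset\mathbb{R}^d$ be a bounded spatial domain, $T>0$, and $\Omega=\Omega_s\times(0,T)$ the space-time domain. Let $\alpha\ge 0$, $\gamma\ge 0$ and $\boldsymbol\beta\in\mathbb{R}^d$ be constants, and set $$Lu=u_t-\alpha\Delta u+\boldsymbol\beta\cdot\nabla u+\gamma u ,$$ where $\nabla,\Delta$ act in the space variables only. $\mathcal H^1_E(\Omega)$ is the subspace of $H^1(\Omega)$ of functions vanishing on $\partial\Omega_s\times(0,T)$ and on $\Omega_s\times\{t=0\}$. Write $(u,v)=\int_{\Omega_s}uv\,dx$ and $\|\cdot\|$ for the $L^2(\Omega_s)$ inner product and norm, and $$B(u,v)=\int_0^T (u_t,v)+\alpha(\nabla u,\nabla v)+(\boldsymbol\beta\cdot\nabla u,v)+\gamma(u,v)\,dt .$$ $\Omega$ is covered by a shape regular quasiuniform tessellation $\mathcal T_h$ of elements of size $h$, and $V_h\subset\mathcal H^1_E(\Omega)$ is a $C^0$ conforming piecewise polynomial finite element space on $\mathcal T_h$. Let $\nu=(|\boldsymbol\beta|^2+1)^{-1/2}$. With exponent $p$ and parameter $\theta$, $$B_h(u,v)=B(u,v)+\int_0^T\big(Lu,\ \theta h^p\nu(\boldsymbol\beta\cdot\nabla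 v+v_t)\big)\,dt ,$$ where the last term is interpreted elementwise on $\mathcal T_h$. The energy norm is $$|||u|||^2=\|u(T)\|^2+\int_0^T \alpha\|\nabla u\|^2+h^p\nu\|\boldsymbol\beta\cdot\nabla u+u_t\|^2+\gamma\|u\|^2\,dt .$$ *)

(* Defs.v *)
From HB Require Import structures.
From mathcomp Require Import all_boot all_order all_algebra.
From mathcomp Require Import all_classical all_reals all_analysis.
From mathcomp Require mpoly.

Set Implicit Arguments.
Unset Strict Implicit.
Unset Printing Implicit Defensive.

Import Order.TTheory GRing.Theory Num.Theory.
Import numFieldNormedType.Exports.

Local Open Scope classical_set_scope.
Local Open Scope ring_scope.

Section measurable_rV.
Context {R : realType} {d : nat}.

Definition rV_coord (i : 'I_d) (x : 'rV[R]_d) : R := x 0 i.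

Let rV_set0 : g_sigma_preimage rV_coord set0.
Proof. exact: sigma_algebra0. Qed.

Let rV_setC A : g_sigma_preimage rV_coord A -> g_sigma_preimage rV_coord (~` A).
Proof. exact: sigma_algebraC. Qed.

Let rV_bigcup (F : _^nat) : (forall i, g_sigma_preimage rV_coord (F i)) ->
  g_sigma_preimage rV_coord (\bigcup_i (F i)).
Proof. exact: sigma_algebra_bigcup. Qed.

(* The sigma-algebra generated by the coordinates, i.e. the Borel sets. *)
HB.instance Definition _ := @isMeasurable.Build
  (measure_tuple_display default_measure_display)
  'rV[R]_d (g_sigma_preimage rV_coord) rV_set0 rV_setC rV_bigcup.

End measurable_rV.

Section rV_cons.
Context {R : realType} {d : nat}.

Definition rV_cons (p : R * 'rV[R]_d) : 'rV[R]_d.+1 :=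
  row_mx (const_mx p.1 : 'rV[R]_1) p.2.

Definition rV_uncons (x : 'rV[R]_d.+1) : R * 'rV[R]_d :=
  (x 0 0, \row_i x 0 (lift ord0 i)).

Lemma rV_cons0 p : rV_cons p 0 0 = p.1.
Proof. by rewrite mxE; case: splitP => [j _|j //]; rewrite mxE. Qed.

Lemma rV_cons_lift p i : rV_cons p 0 (lift ord0 i) = p.2 0 i.
Proof.
rewrite mxE; case: splitP => [j|j]; first by rewrite (ord1 j).
by rewrite lift0 add1n => -[/val_inj->].
Qed.

Lemma rV_consK : cancel rV_cons rV_uncons.
Proof.
move=> [a y]; rewrite /rV_uncons rV_cons0; congr (_, _).
by apply/rowP => i; rewrite mxE rV_cons_lift.
Qed.

End rV_cons.

Lemma measurable_rV_coord (R : realType) d (i : 'I_d) :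
  measurable_fun [set: 'rV[R]_d] (rV_coord i).
Proof.
move=> _ Y mY; rewrite setTI; apply: sub_sigma_algebra => /=.
rewrite -bigcup_seq/=; exists i => /=; first by rewrite mem_index_enum.
by exists Y => //; rewrite setTI.
Qed.

Lemma measurable_fun_rV d0 (T0 : measurableType d0) (R : realType) d
    (f : T0 -> 'rV[R]_d) :
  (forall i, measurable_fun [set: T0] (rV_coord i \o f)) ->
  measurable_fun [set: T0] f.
Proof.
move=> mf; have H : g_sigma_preimage (fun i => rV_coord i \o f) `<=` measurable.
  apply: smallest_sub; first exact: sigma_algebra_measurable.
  case: d => [|n] in f mf *; first by rewrite big_ord0.
  rewrite -bigcup_mkord_ord; apply: bigcup_sub => i Ii.
  by move=> A [B mB <-]; exact: mf.
rewrite g_sigma_preimage_comp in H.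
by move=> _ A mA; apply: H; exists A.
Qed.

Lemma measurable_rV_cons (R : realType) d :
  measurable_fun setT (@rV_cons R d).
Proof.
apply: measurable_fun_rV => i.
case: (unliftP ord0 i) => [j|] ->.
  rewrite (_ : _ \o _ = rV_coord j \o snd).
    by apply: measurableT_comp => //; exact: measurable_rV_coord.
  by apply/funext => p /=; rewrite /rV_coord rV_cons_lift.
rewrite (_ : _ \o _ = fst)//.
by apply/funext => p /=; rewrite /rV_coord rV_cons0.
Qed.

Lemma measurable_rV_uncons (R : realType) d :
  measurable_fun setT (@rV_uncons R d).
Proof.
apply/measurable_fun_pairP; split.
  exact: (measurable_rV_coord (R := R) (ord0 : 'I_d.+1)).
apply: measurable_fun_rV => i.
rewrite (_ : _ \o _ = rV_coord (lift ord0 i)); first exact: measurable_rV_coord.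
by apply/funext => x /=; rewrite /rV_coord mxE.
Qed.

Section rV_prod_measure.
Context {R : realType} {d : nat}.
Variable mu : {sigma_finite_measure set 'rV[R]_d -> \bar R}.

Definition rV_prod_measure : set 'rV[R]_d.+1 -> \bar R :=
  pushforward (lebesgue_measure \x mu)%E rV_cons.

Let measurable_preimage (A : set 'rV[R]_d.+1) : measurable A ->
  measurable (rV_cons @^-1` A : set (measurableTypeR R * 'rV[R]_d)).
Proof.
by move=> mA; rewrite -[X in measurable X]setTI; exact: measurable_rV_cons.
Qed.

Let measure00 : rV_prod_measure set0 = 0%E.
Proof. by rewrite /rV_prod_measure /pushforward preimage_set0 measure0. Qed.

Let measure_nneg A : (0 <= rV_prod_measure A)%E.
Proof. by rewrite /rV_prod_measure /pushforward; exact: measure_ge0. Qed.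

Let measure_additive : semi_sigma_additive rV_prod_measure.
Proof.
move=> F mF tF mUF; rewrite /rV_prod_measure /pushforward preimage_bigcup.
apply: measure_semi_sigma_additive.
- by move=> n; exact: measurable_preimage.
- apply/trivIsetP => /= i j _ _ ij; rewrite -preimage_setI.
  by move/trivIsetP : tF => /(_ _ _ _ _ ij) ->//; rewrite preimage_set0.
- by rewrite -preimage_bigcup; exact: measurable_preimage.
Qed.

HB.instance Definition _ := isMeasure.Build _ _ _ rV_prod_measure
  measure00 measure_nneg measure_additive.

Let measure_sigma_finite : sigma_finite setT rV_prod_measure.
Proof.
have /sigma_finiteP[F [TF ndF Foo]] := sigma_finiteT (@lebesgue_measure R).
have /sigma_finiteP[G [TG ndG Goo]] := sigma_finiteT mu.
exists (fun n => rV_uncons @^-1` (F n `*` G n)).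
  rewrite -preimage_bigcup -[LHS](preimage_setT rV_uncons); congr (_ @^-1` _).
  rewrite -setXTT TF TG predeqE => -[x y]; split.
    move=> [/= [n _ Fnx] [k _ Gky]]; exists (maxn n k) => //; split.
    - by move: x Fnx; exact/subsetPset/ndF/leq_maxl.
    - by move: y Gky; exact/subsetPset/ndG/leq_maxr.
  by move=> [n _ []/= ? ?]; split; exists n.
move=> k; have [mFk Fk] := Foo k; have [mGk Gk] := Goo k; split.
  rewrite -[X in measurable X]setTI; apply: measurable_rV_uncons => //.
  exact: measurableX.
rewrite /rV_prod_measure /pushforward -comp_preimage.
rewrite (_ : _ \o _ = id) ?preimage_id; last first.
  by apply/funext => p /=; rewrite rV_consK.
by rewrite product_measure1E// lte_mul_pinfty// ge0_fin_numE.
Qed.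

HB.instance Definition _ := Measure_isSigmaFinite.Build _ _ _ rV_prod_measure
  measure_sigma_finite.

End rV_prod_measure.

Fixpoint lebesgue_rV (R : realType) (d : nat) :
    {sigma_finite_measure set 'rV[R]_d -> \bar R} :=
  if d is d'.+1 then rV_prod_measure (lebesgue_rV R d')
  else [the {sigma_finite_measure set 'rV[R]_0 -> \bar R} of dirac (0 : 'rV[R]_0)].

Section space_time.
Context {R : realType} {d : nat}.

(* A point of space-time is a pair (x, t). *)
Notation X := ('rV[R]_d * R)%type.
Implicit Types (z w : X) (u v : X -> R) (Os : set 'rV[R]_d) (Om K : set X)
  (M : set (set X)) (T t h p theta alpha gamma : R) (beta : 'rV[R]_d).

Definition cylinder Os T : set X := Os `*` `]0, T[.

Definition space_dir (i : 'I_d) : X := (delta_mx 0 i, 0).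
Definition time_dir : X := (0, 1).

Definition st_dot z w : R := \sum_(i < d) z.1 0 i * w.1 0 i + z.2 * w.2.
(* The library norms on row vectors and on products are sup norms; lengths in
   space-time are Euclidean here. *)
Definition st_norm z : R := Num.sqrt (st_dot z z).
Definition diam K : R := sup [set st_norm (zw.1 - zw.2) | zw in K `*` K].
Definition st_ball z r : set X := [set w | st_norm (w - z) < r].

Definition boundary Os : set 'rV[R]_d := closure Os `\` Os°.

Definition st_lebesgue := (lebesgue_rV R d \x lebesgue_measure)%E.

Fixpoint Ck (k : nat) (phi : X -> R) : Prop :=
  continuous phi /\
  if k is k'.+1 then
    forall e : X, (forall z, derivable phi z e) /\ Ck k' ('D_e phi)
  else True.

Definition test_function Om (phi : X -> R) : Prop :=
  [/\ forall k, Ck k phi,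
      compact (closure [set z | phi z != 0]) &
      closure [set z | phi z != 0] `<=` Om].

Definition L2 Om u : Prop :=
  measurable_fun Om u /\ st_lebesgue.-integrable Om (fun z => (u z ^+ 2)%:E).

Definition weak_derivative Om (e : X) u (g : X -> R) : Prop :=
  forall phi, test_function Om phi ->
    \int[st_lebesgue]_(z in Om) (u z * 'D_e phi z) =
    - \int[st_lebesgue]_(z in Om) (g z * phi z).

Definition H1 Om u : Prop :=
  [/\ L2 Om u,
      forall i, exists2 g, L2 Om g & weak_derivative Om (space_dir i) u g &
      exists2 g, L2 Om g & weak_derivative Om time_dir u g].

(* Members of H^1_E that are continuous up to the boundary: for these the
   vanishing traces on the lateral boundary and on {t = 0} are pointwise
   conditions. *)
Definition C0_H1E Os T u : Prop :=
  [/\ H1 (cylinder Os T) u,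
      {within closure (cylinder Os T), continuous u},
      (forall x t, boundary Os x -> 0 < t < T -> u (x, t) = 0) &
      (forall x, Os x -> u (x, 0) = 0)].

(* Full-dimensional convex polytope: a bounded intersection of finitely many
   closed half-spaces, with nonempty interior. *)
Definition polytope K : Prop :=
  [/\ exists s : seq (X * R),
        K = [set z | forall ab, ab \in s -> st_dot ab.1 z <= ab.2],
      bounded_set K & K° !=set0].

Definition tessellation Om M : Prop :=
  [/\ finite_set M,
      (forall K, M K -> polytope K /\ K° `<=` Om),
      \bigcup_(K in M) K = closure Om &
      forall K K', M K -> M K' -> K <> K' -> K° `&` K'° = set0].

(* [H] is the set of mesh sizes of the family. *)
Definition shape_regular (H : set R) (Th : R -> set (set X)) : Prop :=
  exists2 s : R, 0 < s & forall h K, H h -> Th h K ->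
    exists z, st_ball z (s * diam K) `<=` K.

Definition quasiuniform (H : set R) (Th : R -> set (set X)) : Prop :=
  exists2 s : R, 0 < s & forall h K, H h -> Th h K ->
    s * h <= diam K /\ diam K <= s^-1 * h.

Definition st_coord z (i : 'I_d.+1) : R :=
  if unlift ord_max i is Some j then z.1 0 j else z.2.

Definition piecewise_poly M (k : nat) v : Prop :=
  forall K, M K -> exists2 q : mpoly.mpoly d.+1 R,
    forall m, (k < mpoly.mdeg m)%N -> mpoly.mcoeff m q = 0 &
      {in K, forall z, v z = mpoly.meval (st_coord z) q}.

Definition conforming_poly_space Os T M (k : nat) : set (X -> R) :=
  [set v | C0_H1E Os T v /\ piecewise_poly M k v].

(* Functions are total, but only their values on the closed cylinder matter. *)
Definition finite_element_space Os T M (k : nat) (V : set (X -> R)) : Prop :=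
  [/\ V `<=` conforming_poly_space Os T M k,
      V (cst 0) &
      forall (a : R) u v, V u -> V v -> V (fun z => a * u z + v z)].

(* Derivatives are taken element by element and set to 0 on the mesh skeleton,
   a null set. On a continuous piecewise polynomial function a first-order
   broken derivative is a representative of the weak derivative; iterating it
   gives the elementwise second derivative. *)
Definition bderiv M (e : X) u : X -> R :=
  fun z => if z \in \bigcup_(K in M) K° then 'D_e u z else 0.

Definition dx M (i : 'I_d) := bderiv M (space_dir i).
Definition dt M := bderiv M time_dir.
Definition laplacian M u z : R := \sum_(i < d) dx M i (dx M i u) z.
Definition convection M beta u z : R := \sum_(i < d) beta 0 i * dx M i u z.

Definition L_op M alpha beta gamma u z : R :=
  dt M u z - alpha * laplacian M u z + convection M beta u z + gamma * u z.

Definition slice u t : 'rV[R]_d -> R := fun x => u (x, t).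

Definition ip Os (f g : 'rV[R]_d -> R) : R :=
  \int[lebesgue_rV R d]_(x in Os) (f x * g x).
Definition sqn Os (f : 'rV[R]_d -> R) : R := ip Os f f.

Definition B_form Os T M alpha beta gamma u v : R :=
  \int[lebesgue_measure]_(t in `]0, T[)
    (ip Os (slice (dt M u) t) (slice v t)
     + alpha * (\sum_(i < d) ip Os (slice (dx M i u) t) (slice (dx M i v) t))
     + ip Os (slice (convection M beta u) t) (slice v t)
     + gamma * ip Os (slice u t) (slice v t)).

Definition nu beta : R := (Num.sqrt (\sum_(i < d) beta 0 i ^+ 2 + 1))^-1.

Definition B_h Os T M alpha beta gamma h p theta u v : R :=
  B_form Os T M alpha beta gamma u v
  + \int[lebesgue_measure]_(t in `]0, T[)
      ip Os (slice (L_op M alpha beta gamma u) t)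
            (slice (fun z => theta * h `^ p * nu beta *
                             (convection M beta v z + dt M v z)) t).

Definition energy_sq Os T M alpha beta gamma h p u : R :=
  sqn Os (slice u T)
  + \int[lebesgue_measure]_(t in `]0, T[)
      (alpha * (\sum_(i < d) sqn Os (slice (dx M i u) t))
       + h `^ p * nu beta *
         sqn Os (slice (fun z => convection M beta u z + dt M u z) t)
       + gamma * sqn Os (slice u t)).

End space_time.

(* Main.v *)
Require Import Defs.
From mathcomp Require Import all_boot all_order all_algebra.
From mathcomp Require Import all_classical all_reals all_analysis.
From mathcomp Require Import measurable_realfun.
From mathcomp Require Import ring lra.
Set Implicit Arguments.
Unset Strict Implicit.
Unset Printing Implicit Defensive.
From mathcomp Require mpoly.
Import Order.TTheory GRing.Theory Num.Theory.
Import numFieldNormedType.Exports.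
Local Open Scope classical_set_scope.
Local Open Scope ring_scope.

(** For every [theta] in ]0, 1[ the constant [min theta (1/2)] works.  The
    Laplacian vanishes element by element when [v] is piecewise linear, so with
    [Dv = beta . grad v + v_t] the form [B_h v v] is
      (1 + theta h nu gamma) int v Dv + int (alpha |grad v|^2 + gamma v^2)
        + theta h nu int (Dv)^2,
    and everything reduces to [int v Dv = |v(T)|^2 / 2].  This is proved on
    lines parallel to the axes: off a null set of lines, a line meets the mesh
    skeleton in finitely many points, so that [v] is continuous and piecewise
    polynomial along it and the fundamental theorem of calculus applies.  In
    space, [v] extended by 0 outside the domain stays continuous because it
    vanishes on the lateral boundary. *)

(** * Lebesgue measure on row vectors *)

(** Since [beta] is constant, the convective part of [int v Dv] is a combination of integrals of
    exact derivatives of [v^2 / 2], each equal to 0; only the time part leaves a boundary term. The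
    extra [theta h nu gamma int v Dv] is then nonnegative and is simply dropped: no cross term has
    to be absorbed, so the constant depends on [theta] alone. In it, [theta] pays for the streamline
    term and [1/2] for the final trace. Two obstacles shape the proof. First, [v] is a total
    function, arbitrary off the closed cylinder, while Fubini wants measurable integrands; hence the
    class [mbounded], built from polynomials and indicators, and the replacement of [v] by its
    restriction to the union of the elements. Second, a line lying in a face hyperplane may run
    inside the skeleton along a segment, where [bderiv] is 0 by convention and the fundamental
    theorem fails. Such lines fill a null set that is a union of parallel lines, so multiplying by
    the indicator of its complement changes no integral and acts on each line as a constant, 0 or
    1. *)

Lemma measurable_ball_rV (R : realType) d (x : 'rV[R]_d) (e : R) :
  0 < e -> measurable (ball x e).
Proof.
move=> e0.
rewrite (_ : ball x e = \big[setI/setT]_(i < d) (rV_coord i @^-1` ball (x 0 i) e));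
  last first.
  apply/seteqP; split => y; rewrite -bigcap_seq.
    by move=> -[_ xy] i _; exact: xy.
  move=> xy; split=> // i j; rewrite (ord1 i).
  by apply: (xy j); rewrite /= mem_index_enum.
apply: bigsetI_measurable => i _; rewrite -[X in measurable X]setTI.
apply: measurable_rV_coord => //; by rewrite ball_itv; exact: measurable_itv.
Qed.

Lemma rV_rat_dense (R : realType) d (x : 'rV[R]_d) (e : R) : 0 < e ->
  exists q : 'rV[rat]_d, ball (map_mx ratr q : 'rV[R]_d) e x.
Proof.
move=> e0.
have /choice[f fP] : forall i, exists q : rat, ball (ratr q : R) e (x 0 i).
  move=> i; have /rat_in_itvoo[q] : x 0 i - e < x 0 i + e by lra.
  rewrite in_itv/= => /andP[h1 h2]; exists q.
  by rewrite /ball/= ltr_norml; apply/andP; split; lra.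
exists (\row_i f i); split=> // i j; rewrite (ord1 i) !mxE; exact: fP.
Qed.

(** The sigma-algebra comes from the coordinates, not from the topology. The two are linked by a
    countable base: boxes with rational centre and radius [1 / (n + 1)]. *)
Lemma open_measurable_st (R : realType) d (U : set ('rV[R]_d * R)) :
  open U -> measurable U.
Proof.
move=> oU.
pose B (c : 'rV[rat]_d * rat * nat) : set ('rV[R]_d * R) :=
  ball (map_mx ratr c.1.1 : 'rV[R]_d) (c.2.+1%:R^-1) `*` ball (ratr c.1.2 : R)
    (c.2.+1%:R^-1).
have -> : U = \bigcup_c (if `[< B c `<=` U >] then B c else set0).
  apply/seteqP; split; last by move=> z [c _]; case: asboolP => // cU /cU.
  move=> z Uz; have /nbhs_ballP[e /= e0 eU] := open_nbhs_nbhs (conj oU Uz).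
  have [n ne] : exists n : nat, n.+1%:R^-1 < e / 2.
    have e20 : 0 < e / 2 by rewrite divr_gt0.
    by have [n] := ltr_add_invr e20; rewrite add0r; exists n.
  have nn : n.+1%:R^-1 + n.+1%:R^-1 <= e by move: ne; move: (n.+1%:R^-1 : R) => a; lra.
  have n0 : 0 < n.+1%:R^-1 :> R by [].
  have [q qz] := rV_rat_dense z.1 n0.
  have [r rz] : exists r : rat, ball (ratr r : R) n.+1%:R^-1 z.2.
    have [q' q'z] := rV_rat_dense (const_mx z.2 : 'rV_1) n0.
    by exists (q' 0 0); have [_ /(_ 0 0)] := q'z; rewrite !mxE.
  exists (q, r, n) => //; rewrite ifT; first by split.
  apply/asboolP => y [/= y1 y2]; apply: eU; split.
    by apply: (@le_ball _ _ _ (n.+1%:R^-1 + n.+1%:R^-1)); [exact: nn|];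
      apply: ball_triangle y1; apply: ball_sym.
  by apply: (@le_ball _ _ _ (n.+1%:R^-1 + n.+1%:R^-1)); [exact: nn|];
    apply: ball_triangle y2; apply: ball_sym.
apply: countable_bigcupT_measurable; first exact: countableP.
move=> c; case: ifP => _ //; apply: measurableX.
  by apply: measurable_ball_rV; rewrite invr_gt0 ltr0n.
by rewrite ball_itv; exact: measurable_itv.
Qed.

Lemma measurable_cube_rV (R : realType) d (r : R) :
  measurable [set x : 'rV[R]_d | forall i, `|x ord0 i| <= r].
Proof.
rewrite (_ : [set x | _] = \big[setI/setT]_(i < d) (rV_coord i @^-1` `[-r, r])); last first.
  apply/seteqP; split => y; rewrite -bigcap_seq.
    by move=> h i _; rewrite /= in_itv/= -ler_norml; exact: h.
  move=> h i; have := h i; rewrite /= in_itv/= -ler_norml; apply.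
  by rewrite /= mem_index_enum.
apply: bigsetI_measurable => i _; rewrite -[X in measurable X]setTI.
by apply: measurable_rV_coord => //; exact: measurable_itv.
Qed.

Lemma lebesgue_rV_cube_fin (R : realType) d (r : R) :
  (lebesgue_rV R d [set x : 'rV[R]_d | forall i, (`|x ord0 i| <= r)%R] < +oo)%E.
Proof.
elim: d => [|d IH] /=.
  by rewrite /dirac ltry.
rewrite /rV_prod_measure/= /pushforward.
rewrite (_ : _ @^-1` _ = `[-r, r] `*` [set x : 'rV[R]_d | forall i, `|x 0 i| <= r]);
  last first.
  apply/seteqP; split=> -[s y] /=.
    move=> h; split; first by rewrite in_itv/= -ler_norml; have := h 0; rewrite rV_cons0.
    by move=> i; have := h (lift ord0 i); rewrite rV_cons_lift.
  rewrite in_itv/= -ler_norml => -[h1 h2] i; case: (unliftP ord0 i) => [j|] ->.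
    by rewrite rV_cons_lift.
  by rewrite rV_cons0.
rewrite product_measure1E//; last exact: measurable_cube_rV.
have h : (lebesgue_measure ([set` `[- r, r]%R] : set R) < +oo)%E.
  by rewrite lebesgue_measure_itv/=; case: ifP => _; rewrite ?ltry// -EFinB ltry.
by apply: lte_mul_pinfty => //; rewrite ge0_fin_numE.
Qed.

Lemma coord_le_norm (R : realType) d (x : 'rV[R]_d) i : `|x 0 i| <= `|x|.
Proof.
rewrite [leRHS]mx_normrE.
exact: (le_bigmax _ (fun ij : 'I_1 * 'I_d => `|x ij.1 ij.2|) (0, i)).
Qed.

Lemma lebesgue_rV_bounded_fin (R : realType) d (A : set 'rV[R]_d) :
  measurable A -> bounded_set A -> (lebesgue_rV R d A < +oo)%E.
Proof.
move=> mA [M [_ AM]].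
have {}AM x : A x -> `|x| <= M + 1 by apply: AM; rewrite ltrDl.
apply: le_lt_trans (lebesgue_rV_cube_fin d (M + 1)).
apply: le_measure; rewrite ?inE//; first exact: measurable_cube_rV.
by move=> x Ax i; apply: le_trans (AM _ Ax); exact: coord_le_norm.
Qed.

Lemma integrable_bounded_supp d (T : measurableType d) (R : realType)
    (mu : {measure set T -> \bar R}) (A : set T) (f : T -> R) (M : R) :
  measurable A -> (mu A < +oo)%E -> measurable_fun setT f ->
  (forall x, `|f x| <= M) -> (forall x, ~ A x -> f x = 0) ->
  mu.-integrable setT (EFin \o f).
Proof.
move=> mA Afin mf fM f0.
have -> : EFin \o f = (EFin \o f) \_ A.
  apply/funext => x; rewrite patchE; case: ifPn => // /negP xA.
  by rewrite /= f0// => Ax; apply: xA; rewrite inE.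
apply/(integrable_mkcond _ mA); apply: measurable_bounded_integrable => //.
  exact: measurable_funTS.
exists M; split; first exact: num_real.
by move=> y My x _; exact: le_trans (fM x) (ltW My).
Qed.

Lemma integrable_rV_cons (R : realType) d (f : 'rV[R]_d.+1 -> R) :
  measurable_fun setT f -> (lebesgue_rV R d.+1).-integrable setT (EFin \o f) ->
  (lebesgue_measure \x lebesgue_rV R d)%E.-integrable setT (EFin \o (f \o rV_cons)).
Proof.
move=> mf /integrableP[_ fi]; apply/integrableP; split.
  apply/measurable_EFinP; apply: measurableT_comp => //; exact: measurable_rV_cons.
apply: le_lt_trans fi => /=.
rewrite /rV_prod_measure/=.
rewrite ge0_integral_pushforward//.
- exact: measurable_rV_cons.
- by apply/measurable_EFinP; exact: measurableT_comp.
Qed.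

Lemma rV_consD (R : realType) d (s s' : R) (y y' : 'rV[R]_d) :
  rV_cons (s + s', y + y') = rV_cons (s, y) + rV_cons (s', y').
Proof.
apply/rowP => i; rewrite [RHS]mxE; case: (unliftP ord0 i) => [j|] ->.
  by rewrite !rV_cons_lift [LHS]mxE.
by rewrite !rV_cons0.
Qed.

Lemma rV_cons_delta0 (R : realType) d (s : R) :
  s *: delta_mx 0 ord0 = rV_cons (s, 0 : 'rV[R]_d).
Proof.
apply/rowP => i; case: (unliftP ord0 i) => [j|] ->.
  by rewrite rV_cons_lift !mxE/= mulr0.
by rewrite rV_cons0 !mxE/= mulr1.
Qed.

Lemma rV_cons_delta_lift (R : realType) d (s : R) (j : 'I_d) :
  s *: delta_mx 0 (lift ord0 j) = rV_cons (0, s *: delta_mx 0 j : 'rV[R]_d).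
Proof.
apply/rowP => i; case: (unliftP ord0 i) => [k|] ->.
  by rewrite rV_cons_lift !mxE/= (inj_eq (@lift_inj _ ord0)).
by rewrite rV_cons0 !mxE/= mulr0.
Qed.

(** Fubini without permuting coordinates. [lebesgue_rV] splits off coordinate 0: if [i] is that
    coordinate, it is integrated first; otherwise coordinate 0 is frozen and the induction
    hypothesis applies to the slice. The uniform bound and the support in a cube pass to slices and
    give integrability at every level. *)
Lemma integral_lines_eq0 (R : realType) d (i : 'I_d) (f : 'rV[R]_d -> R) (M r : R) :
  measurable_fun setT f -> (forall x, `|f x| <= M) ->
  (forall x : 'rV[R]_d, ~ (forall j, `|x 0 j| <= r) -> f x = 0) ->
  (forall x, (\int[lebesgue_measure]_s (f (x + s *: delta_mx 0 i))%:E = 0)%E) ->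
  (\int[lebesgue_rV R d]_x (f x)%:E = 0)%E.
Proof.
elim: d => [|d IH] in i f *; first by case: i.
move=> mf fM fr f0.
have fi : (lebesgue_rV R d.+1).-integrable setT (EFin \o f).
  apply: (@integrable_bounded_supp _ _ _ _ [set x : 'rV[R]_d.+1 | forall j, `|x ord0 j|
    <= r] _ M) => //.
    exact: measurable_cube_rV.
  exact: lebesgue_rV_cube_fin.
have fci := integrable_rV_cons mf fi.
have -> : (\int[lebesgue_rV R d.+1]_x (f x)%:E =
    \int[lebesgue_measure \x lebesgue_rV R d]_p (f (rV_cons p))%:E)%E.
  rewrite /= /rV_prod_measure/= integral_pushforward//.
  exact: measurable_rV_cons.
  exact/measurable_EFinP.
have [j|] := unliftP ord0 i => ei; last first.
  rewrite -(integral21_prod_meas1 fci) /fubini_G/=.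
  apply: integral0_eq => y _; rewrite -[RHS](f0 (rV_cons (0, y))).
  apply: eq_integral => s _.
  by rewrite ei rV_cons_delta0 -rV_consD add0r addr0.
rewrite -(integral12_prod_meas1 fci) /fubini_F/=.
apply: integral0_eq => s _; apply: (IH j).
- apply: measurableT_comp => //; apply: measurableT_comp.
    exact: measurable_rV_cons.
  exact: pair1_measurable.
- by [].
- move=> y yr; apply: fr => h; apply: yr => k.
  by have := h (lift ord0 k); rewrite rV_cons_lift.
- move=> y; rewrite -[RHS](f0 (rV_cons (s, y))).
  apply: eq_integral => t _.
  by rewrite ei rV_cons_delta_lift -rV_consD addr0.
Qed.

Definition rV_dot (R : realType) d (a x : 'rV[R]_d) := \sum_(i < d) a 0 i * x 0 i.

Lemma measurable_rV_dot (R : realType) d (a : 'rV[R]_d) :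
  measurable_fun setT (rV_dot a).
Proof.
apply: measurable_sum => i; apply: measurable_funM => //.
exact: measurable_rV_coord.
Qed.

Lemma lebesgue_rV_hyperplane (R : realType) d (a : 'rV[R]_d) (b : R) :
  a != 0 -> lebesgue_rV R d [set x | rV_dot a x = b] = 0%E.
Proof.
elim: d => [|d IH] in a b *.
  by move=> /negP[]; apply/eqP/rowP => -[].
move=> a0 /=; rewrite /rV_prod_measure/= /pushforward.
set a' := \row_j a 0 (lift ord0 j) : 'rV_d.
have dotE s y : rV_dot a (rV_cons (s, y)) = a 0 0 * s + rV_dot a' y.
  rewrite /rV_dot big_ord_recl rV_cons0; congr (_ + _).
  by apply: eq_bigr => i _; rewrite rV_cons_lift mxE.
have mA : measurable (rV_cons @^-1` [set x | rV_dot a x = b] : set (measurableTypeR R *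
  'rV[R]_d)).
  rewrite -[X in measurable X]setTI; apply: measurable_rV_cons => //.
  rewrite -[X in measurable X]setTI.
  exact: (measurable_rV_dot a measurableT (measurable_set1 b)).
have [a'0|a'0] := eqVneq a' 0; last first.
  apply: integral0_eq => s _ /=; rewrite -[RHS](IH a' (b - a 0 0 * s))//;
    congr (lebesgue_rV R d _).
  apply/seteqP; split => y; rewrite /xsection/= inE/= dotE => h; rewrite -?h; lra.
have a00 : a 0 0 != 0.
  apply: contra_neq a0 => a00; apply/rowP => i; case: (unliftP ord0 i) => [j|] ->;
    rewrite mxE//.
  by have := congr1 (fun u : 'rV_d => u 0 j) a'0; rewrite !mxE.
have -> : rV_cons @^-1` [set x | rV_dot a x = b] = [set b / a 0 0] `*` [set: 'rV[R]_d].
  have d0 y : rV_dot a' y = 0.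
    by rewrite a'0 /rV_dot big1// => i _; rewrite mxE mul0r.
  apply/seteqP; split => -[s y] /=; rewrite dotE d0 addr0.
    by move=> <-; split=> //; rewrite mulrAC divff// mul1r.
  by move=> [-> _]; rewrite mulrCA divff// mulr1.
rewrite product_measure1E//.
(* The second factor may be infinite; the product is still 0 by the convention [0 * +oo = 0]. *)
transitivity (0 * lebesgue_rV R d setT)%E; last by rewrite mul0e.
by congr (_ * _)%E; exact: lebesgue_measure_set1.
Qed.

Lemma st_dotE (R : realType) d (a z : 'rV[R]_d * R) :
  st_dot a z = rV_dot a.1 z.1 + a.2 * z.2.
Proof. by []. Qed.

Lemma measurable_st_dot (R : realType) d (a : 'rV[R]_d * R) :
  measurable_fun setT (st_dot a).
Proof.
apply: measurable_funD.
  by apply: (measurableT_comp (measurable_rV_dot a.1)).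
by apply: measurable_funM.
Qed.

Lemma measurable_st_hyperplane (R : realType) d (a : 'rV[R]_d * R) (b : R) :
  measurable [set z | st_dot a z = b].
Proof.
rewrite -[X in measurable X]setTI.
exact: (measurable_st_dot a measurableT (measurable_set1 b)).
Qed.

Lemma st_lebesgue_hyperplane (R : realType) d (a : 'rV[R]_d * R) (b : R) :
  a != 0 -> st_lebesgue [set z | st_dot a z = b] = 0%E.
Proof.
move=> a0; have mA := measurable_st_hyperplane a b.
have [a1|a1] := eqVneq a.1 0.
  have a2 : a.2 != 0.
    by apply: contra_neq a0 => a2; case: a a1 a2 {mA} => ? ? /= -> ->.
  apply: integral0_eq => x _ /=; rewrite -[RHS](lebesgue_measure_set1 (b / a.2));
    congr (lebesgue_measure _).
  apply/seteqP; split => t; rewrite /xsection/= inE/= st_dotE a1 /rV_dot big1 ?add0r.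
  - by move=> /= <-; rewrite mulrAC divff// mul1r.
  - by move=> i _; rewrite mxE mul0r.
  - by move=> ->; rewrite /= mulrCA divff// mulr1.
  - by move=> i _; rewrite mxE mul0r.
(* The product measure integrates the measures of time sections, but it is the spatial sections that
   are hyperplanes here. Uniqueness of the product measure gives the other order. *)
have -> : st_lebesgue [set z | st_dot a z = b] =
    (\int[lebesgue_measure]_t (lebesgue_rV R d \o ysection [set z | st_dot a z = b]) t)%E.
  have -> : (\int[lebesgue_measure]_t (lebesgue_rV R d \o ysection [set z | st_dot a z =
    b]) t)%E =
     (lebesgue_rV R d \x^ lebesgue_measure)%E [set z | st_dot a z = b] by [].
  apply: product_measure_unique => //.
  by move=> A B mA' mB'; exact: product_measure2E.
apply: integral0_eq => t _ /=;
  rewrite -[RHS](@lebesgue_rV_hyperplane R d a.1 (b - a.2 * t) a1).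
congr (lebesgue_rV R d _).
by apply/seteqP; split => y; rewrite /ysection/= inE/= st_dotE/= => h; rewrite -?h; lra.
Qed.

(** * Polynomial functions along lines *)

Section line_polynomial.
Context {R : realType} {d : nat}.
Local Notation X := ('rV[R]_d * R)%type.
Implicit Types (f g : X -> R) (z e : X) (r s : R).

Definition st_box r : set X := [set z : X | (forall i, `|z.1 0 i| <= r) /\ `|z.2| <= r].

(** The working class of integrands: stable under sums and products, and integrable over the bounded
    cylinder, over its slices and over segments without further checks. *)
Definition mbounded f :=
  measurable_fun setT f /\ forall r, exists B, forall z, st_box r z -> `|f z| <= B.

Lemma mbounded_cst (a : R) : mbounded (cst a).
Proof. by split=> // r; exists `|a|. Qed.

Lemma mboundedD f g : mbounded f -> mbounded g -> mbounded (fun z => f z + g z).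
Proof.
move=> [mf bf] [mg bg]; split; first exact: measurable_funD.
move=> r; have [A fA] := bf r; have [B gB] := bg r; exists (A + B) => z zr.
by apply: le_trans (ler_normD _ _) _; apply: lerD; [exact: fA|exact: gB].
Qed.

Lemma mboundedM f g : mbounded f -> mbounded g -> mbounded (fun z => f z * g z).
Proof.
move=> [mf bf] [mg bg]; split; first exact: measurable_funM.
move=> r; have [A fA] := bf r; have [B gB] := bg r; exists (A * B) => z zr.
by rewrite normrM; apply: ler_pM => //; [exact: fA|exact: gB].
Qed.

Lemma mbounded_sum (I : Type) (s : seq I) (F : I -> X -> R) :
  (forall i, mbounded (F i)) -> mbounded (fun z => \sum_(i <- s) F i z).
Proof.
move=> mF; elim: s => [|i s IH].
  by under eq_fun do rewrite big_nil; exact: mbounded_cst.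
by under eq_fun do rewrite big_cons; exact: mboundedD.
Qed.

(* The coefficients 0 and 1 of [c] are [f] and its derivative along [e]: this is
   how both are seen to be measurable and locally bounded. *)
Definition line_poly e f := exists2 c : X -> {poly R},
  (forall z s, f (z + s *: e) = (c z).[s]) & forall k, mbounded (fun z => (c z)`_k).

Lemma line_poly_cst e (a : R) : line_poly e (cst a).
Proof.
exists (fun=> a%:P) => [z s|k]; first by rewrite hornerC.
by exact: mbounded_cst.
Qed.

Lemma line_polyD e f g : line_poly e f -> line_poly e g ->
  line_poly e (fun z => f z + g z).
Proof.
move=> [p pE mp] [q qE mq]; exists (fun z => p z + q z) => [z s|k].
  by rewrite hornerD pE qE.
by under eq_fun do rewrite coefD; exact: mboundedD.
Qed.

Lemma line_polyM e f g : line_poly e f -> line_poly e g ->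
  line_poly e (fun z => f z * g z).
Proof.
move=> [p pE mp] [q qE mq]; exists (fun z => p z * q z) => [z s|k].
  by rewrite hornerM pE qE.
under eq_fun do rewrite coefM.
by apply: mbounded_sum => i; exact: mboundedM.
Qed.

Lemma line_poly_sum e (I : Type) (s : seq I) (F : I -> X -> R) :
  (forall i, line_poly e (F i)) -> line_poly e (fun z => \sum_(i <- s) F i z).
Proof.
move=> mF; elim: s => [|i s IH].
  by under eq_fun do rewrite big_nil; exact: line_poly_cst.
by under eq_fun do rewrite big_cons; exact: line_polyD.
Qed.

Lemma line_poly_prod e (I : Type) (s : seq I) (F : I -> X -> R) :
  (forall i, line_poly e (F i)) -> line_poly e (fun z => \prod_(i <- s) F i z).
Proof.
move=> mF; elim: s => [|i s IH].
  by under eq_fun do rewrite big_nil; exact: line_poly_cst.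
by under eq_fun do rewrite big_cons; exact: line_polyM.
Qed.

Lemma line_polyX e f n : line_poly e f -> line_poly e (fun z => f z ^+ n).
Proof.
move=> lf; elim: n => [|n IH].
  by under eq_fun do rewrite expr0; exact: line_poly_cst.
by under eq_fun do rewrite exprS; exact: line_polyM.
Qed.

Lemma st_coordD z z' i : st_coord (z + z') i = st_coord z i + st_coord z' i.
Proof. by rewrite /st_coord; case: unlift => [j|//]; rewrite [LHS]mxE. Qed.

Lemma st_coordZ s z i : st_coord (s *: z) i = s * st_coord z i.
Proof. by rewrite /st_coord; case: unlift => [j|//]; rewrite [LHS]mxE. Qed.

Lemma mbounded_st_coord i : mbounded (fun z => st_coord z i).
Proof.
rewrite /st_coord; case: unlift => [j|]; split.
- by apply: (measurableT_comp (measurable_rV_coord j)).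
- by move=> r; exists r => z [].
- exact: measurable_snd.
- by move=> r; exists r => z [].
Qed.

Lemma line_poly_st_coord e i : line_poly e (fun z => st_coord z i).
Proof.
exists (fun z => (st_coord z i)%:P + (st_coord e i) *: 'X) => [z s|k].
  by rewrite !hornerE st_coordD st_coordZ mulrC.
under eq_fun do rewrite coefD coefC coefZ.
apply: mboundedD; last exact: mbounded_cst.
by case: (k == 0%N); [exact: mbounded_st_coord|exact: mbounded_cst].
Qed.

Lemma line_poly_meval e (q : mpoly.mpoly d.+1 R) :
  line_poly e (fun z => mpoly.meval (st_coord z) q).
Proof.
under eq_fun do rewrite mpoly.mevalE.
apply: line_poly_sum => m; apply: line_polyM; first exact: line_poly_cst.
by apply: line_poly_prod => i; apply: line_polyX; exact: line_poly_st_coord.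
Qed.

(** A directional derivative sees [f] along one line only: its difference quotient at [z] is that of
    [p] at 0, so no differentiability in several variables is involved. *)
Lemma derive_line f z e (p : {poly R}) :
  (forall h, f (z + h *: e) = p.[h]) -> 'D_e f z = p^`().[0].
Proof.
move=> fE; transitivity ('D_1 (horner p) (0 : R)); last first.
  by have ? := is_derive_poly p 0; rewrite derive_val.
rewrite /derive.
have -> // : (fun h : R => h^-1 *: ((f \o shift z) (h *: e) - f z)) =
  (fun h : R => h^-1 *: ((horner p \o shift 0) (h *: (1 : R)) - p.[0])).
apply/funext => h /=.
by rewrite addr0 [h%:A]mulr1 -!fE scale0r addr0 (addrC z).
Qed.

Lemma derive_lineS f z e (p : {poly R}) s :
  (forall h, f (z + h *: e) = p.[h]) -> 'D_e f (z + s *: e) = p^`().[s].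
Proof.
move=> fE; rewrite (@derive_line f _ e (p \Po ('X + s%:P))).
  by rewrite deriv_comp derivD derivX derivC addr0 mulr1 horner_comp hornerD hornerX
    hornerC add0r.
by move=> h; rewrite -addrA -scalerDl fE horner_comp hornerD hornerX hornerC (addrC s).
Qed.

Lemma mbounded_line_poly e f : line_poly e f -> mbounded f.
Proof.
move=> [p pE mp]; rewrite (_ : f = fun z => (p z)`_0)//; apply/funext => z.
by rewrite -horner_coef0 -pE scale0r addr0.
Qed.

Lemma mbounded_derive e f : line_poly e f -> mbounded ('D_e f).
Proof.
move=> [p pE mp]; rewrite (_ : 'D_e f = fun z => (p z)`_1)//; apply/funext => z.
by rewrite (derive_line (pE z)) horner_coef0 coef_deriv mulr1n.
Qed.

End line_polynomial.

(** * Fundamental theorem of calculus for continuous piecewise polynomials *)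

Section piecewise_FTC.
Context {R : realType}.
Local Notation mu := (@lebesgue_measure R).

Lemma integral_poly (p : {poly R}) (a b : R) : a < b ->
  (\int[mu]_(x in `[a, b]) (p^`().[x])%:E = (p.[b] - p.[a])%:E)%E.
Proof.
move=> ab; rewrite (@continuous_FTC2 _ (fun x => p^`().[x]) (horner p))//.
- by apply: continuous_subspaceT; exact: continuous_horner.
- split; first by move=> x _; exact: derivable_horner.
  + by apply: cvg_at_right_filter; exact: continuous_horner.
  + by apply: cvg_at_left_filter; exact: continuous_horner.
- by move=> x _; rewrite derive1E; have ? := is_derive_poly p x; rewrite derive_val.
Qed.

Lemma integrable_itv_sub (a b c e : R) (g : R -> R) : a <= c -> e <= b ->
  mu.-integrable `[a, b] (EFin \o g) -> mu.-integrable `[c, e] (EFin \o g).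
Proof.
move=> ac eb; apply: integrableS => //.
by apply: subset_itv; rewrite leBSide.
Qed.

(** Induction on the break points, cutting the interval at each one that is interior to it.
    Quantifying over all subintervals free of [E] makes the hypothesis pass to both halves, and [E]
    may be unsorted or contain points outside the interval. With no break point left, one polynomial
    serves on the open interval, and continuity of [phi] carries the equality to both ends. *)
Lemma Rintegral_piecewise_poly (E : seq R) (phi g : R -> R) (a b : R) :
  a <= b -> {within `[a, b], continuous phi} ->
  mu.-integrable `[a, b] (EFin \o g) ->
  (forall c e, a <= c -> c < e -> e <= b -> (forall x, x \in E -> ~~ (c < x < e)) ->
    exists p : {poly R}, forall s, c < s < e -> phi s = p.[s] /\ g s = p^`().[s]) ->
  \int[mu]_(s in `[a, b]) g s = phi b - phi a.
Proof.
elim: E a b => [|x E IH] a b.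
  rewrite le_eqVlt => /predU1P[-> _ _ _|ab cphi ig].
    by rewrite set_itv1 Rintegral_set1 subrr.
  case/(_ a b (lexx a) ab (lexx b)) => // p pE.
  have /(continuous_within_itvP _ ab)[_ ca cb] := cphi.
  have pa : phi a = p.[a].
    have h : phi x @[x --> a^'+] --> p.[a].
      apply: cvg_trans; last by apply: cvg_at_right_filter;
        exact: (@continuous_horner _ p a).
      apply: near_eq_cvg; near=> s; apply/esym; apply: (pE s _).1.
      by apply/andP; split; near: s; [exact: nbhs_right_gt|exact: nbhs_right_lt].
    by rewrite -(cvg_lim _ h)// (cvg_lim _ ca).
  have pb : phi b = p.[b].
    have h : phi x @[x --> b^'-] --> p.[b].
      apply: cvg_trans; last by apply: cvg_at_left_filter;
        exact: (@continuous_horner _ p b).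
      apply: near_eq_cvg; near=> s; apply/esym; apply: (pE s _).1.
      by apply/andP; split; near: s; [exact: nbhs_left_gt|exact: nbhs_left_lt].
    by rewrite -(cvg_lim _ h)// (cvg_lim _ cb).
  rewrite pa pb -[RHS]/(fine (p.[b] - p.[a])%:E) -integral_poly//.
  rewrite /Rintegral; congr fine.
  have mg : measurable_fun `]a, b[ (EFin \o g).
    by apply: measurable_funS (measurable_int _ ig) => //; exact: subset_itv_oo_cc.
  have mp : measurable_fun `]a, b[ (fun s => (p^`().[s])%:E).
    apply/measurable_EFinP; apply: measurable_funTS.
    by apply: continuous_measurable_fun; exact: continuous_horner.
  rewrite (integral_itv_bndoo true false mg) (integral_itv_bndoo true false mp).
  by apply: eq_integral => s; rewrite inE/= in_itv/= => sab; rewrite (pE s sab).2.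
move=> ab cphi ig h.
have [axb|axb] := boolP (a < x < b); last first.
  apply: IH => // c e ac ce eb cE; apply: h => // y; rewrite inE => /predU1P[->|];
    last exact: cE.
  apply: contra axb => /andP[cx xe]; apply/andP; split;
    [exact: le_lt_trans cx|exact: lt_le_trans eb].
have /andP[/ltW ax /ltW xb] := axb.
rewrite -(subrK (phi x) (phi b)) -addrA -(IH x b)//; last 3 first.
- by apply: continuous_subspaceW cphi; apply: subset_itv; rewrite bnd_simp.
- exact: integrable_itv_sub ig.
- move=> c e xc ce eb cE; apply: h => //; first exact: le_trans xc.
  move=> y; rewrite inE => /predU1P[->|]; last exact: cE.
  by rewrite negb_and -leNgt xc.
rewrite -(IH a x)//; last 3 first.
- by apply: continuous_subspaceW cphi; apply: subset_itv; rewrite bnd_simp.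
- exact: integrable_itv_sub ig.
- move=> c e xc ce eb cE; apply: h => //; first exact: le_trans xb.
  move=> y; rewrite inE => /predU1P[->|]; last exact: cE.
  by rewrite negb_and -!leNgt eb orbT.
have ixb : mu.-integrable `]x, b] (EFin \o g).
  by apply: integrableS ig => //; apply: subset_itv; rewrite bnd_simp.
by rewrite -(Rintegral_itv_obnd_cbnd ixb) -(Rintegral_itvB ig) ?bnd_simp// subrK.
Unshelve. all: by end_near. Qed.

End piecewise_FTC.

(** * Meshes of polytopes *)

Section polytopes.
Context {R : realType} {d : nat}.
Local Notation X := ('rV[R]_d * R)%type.
Implicit Types (z e : X) (K : set X) (M : set (set X)) (L : seq (X * R)).

Lemma st_dotDr (a z z' : X) : st_dot a (z + z') = st_dot a z + st_dot a z'.
Proof.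
rewrite /st_dot/= mulrDr addrACA -big_split; congr (_ + _).
by apply: eq_bigr => i _; rewrite !mxE mulrDr.
Qed.

Lemma st_dotZr (a z : X) (s : R) : st_dot a (s *: z) = s * st_dot a z.
Proof.
rewrite /st_dot/= mulrDr big_distrr/=; congr (_ + _); last exact: mulrCA.
by apply: eq_bigr => i _; rewrite !mxE mulrCA.
Qed.

Lemma st_dot_continuous (a : X) : continuous (st_dot a).
Proof.
move=> z; apply: cvgD; last first.
  by apply: cvgM; [exact: cvg_cst|exact: cvg_snd].
apply: cvg_big => [|i _]; first exact: add_continuous.
apply: cvgM; first exact: cvg_cst.
apply: (@continuous_comp _ _ _ fst (fun x : 'rV[R]_d => x 0 i)); first exact: cvg_fst.
exact: coord_continuous.
Qed.

Lemma polytope_faces K : polytope K -> exists L,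
  (forall ab, ab \in L -> ab.1 != 0) /\
  K = [set z | forall ab, ab \in L -> st_dot ab.1 z <= ab.2].
Proof.
move=> [[L KE] _ [z0 /interior_subset Kz0]].
exists [seq ab <- L | ab.1 != 0]; split; first by move=> ab; rewrite mem_filter => /andP[].
rewrite KE in Kz0 *; apply/seteqP; split=> z /= zL ab.
  by rewrite mem_filter => /andP[_]; exact: zL.
move=> abL; have [a0|a0] := eqVneq ab.1 0; last by apply: zL; rewrite mem_filter a0.
have := Kz0 _ abL; rewrite a0.
have st0 y : st_dot (0 : X) y = 0.
  rewrite /st_dot (_ : (0 : X).2 = 0)// mul0r addr0 big1// => i _.
  by rewrite (_ : (0 : X).1 = 0)// mxE mul0r.
by rewrite !st0.
Qed.

Lemma interior_faces L z : (forall ab, ab \in L -> st_dot ab.1 z < ab.2) ->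
  [set w : X | forall ab, ab \in L -> st_dot ab.1 w <= ab.2]° z.
Proof.
elim: L => [_|ab L IH zL]; first exact: filterE.
have zab : \forall w \near z, st_dot ab.1 w < ab.2.
  by apply: (cvgr_lt (st_dot ab.1 z) (@st_dot_continuous ab.1 z)); apply: zL;
    rewrite mem_head.
have zL' : \forall w \near z, forall ab, ab \in L -> st_dot ab.1 w <= ab.2.
  by apply: IH => ab' ab'L; apply: zL; rewrite inE ab'L orbT.
apply: filterS2 zab zL' => w w1 w2 ab'; rewrite inE => /predU1P[->|].
  exact: ltW.
exact: w2.
Qed.

(* [F K] lists the faces of the element [K], and [L] those of all elements. *)
Definition mesh_faces M (F : set X -> seq (X * R)) L :=
  (forall ab, ab \in L -> ab.1 != 0) /\
  forall K, M K -> {subset F K <= L} /\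
    K = [set z | forall ab, ab \in F K -> st_dot ab.1 z <= ab.2].

Lemma exists_mesh_faces M : finite_set M -> (forall K, M K -> polytope K) ->
  exists F L, mesh_faces M F L.
Proof.
move=> /finite_seqP[Ms ME] polyM.
have /choice[F FP] : forall K, exists L, M K ->
    (forall ab, ab \in L -> ab.1 != 0) /\
    K = [set z | forall ab, ab \in L -> st_dot ab.1 z <= ab.2].
  move=> K; have [MK|nMK] := pselect (M K); last by exists [::].
  by have [L LP] := polytope_faces (polyM K MK); exists L.
exists F, (flatten [seq F K | K <- Ms]); split.
  move=> ab /flatten_mapP[K KMs]; apply: (FP K _).1.
  by rewrite ME.
move=> K MK; split; last exact: (FP K MK).2.
move=> ab abK; apply/flatten_mapP; exists K => //.
by rewrite ME in MK.
Qed.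

(* The line through [z] of direction [e] lies in no face hyperplane, hence meets
   the union of these hyperplanes in finitely many points. *)
Definition generic_line L z e := forall ab, ab \in L ->
  st_dot ab.1 e != 0 \/ st_dot ab.1 z != ab.2.

Definition line_roots L z e : seq R :=
  [seq (ab.2 - st_dot ab.1 z) / st_dot ab.1 e | ab <- L].

Lemma line_faceE (ab : X * R) z e s : st_dot ab.1 e != 0 ->
  st_dot ab.1 (z + s *: e) - ab.2 =
  st_dot ab.1 e * (s - (ab.2 - st_dot ab.1 z) / st_dot ab.1 e).
Proof. by move=> ae0; rewrite st_dotDr st_dotZr; field. Qed.

(** Along a generic line the defining function of a face is either a nonzero constant or affine with
    its single root in [line_roots], so its sign cannot change between [c] and [c']. Equality never
    occurs there, whence the strict inequality also in the second conclusion. *)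
Lemma generic_line_sign L z e c c' m s : generic_line L z e ->
  (forall x, x \in line_roots L z e -> ~~ (c < x < c')) ->
  c < m < c' -> c < s < c' ->
  forall ab, ab \in L ->
  (st_dot ab.1 (z + m *: e) < ab.2 -> st_dot ab.1 (z + s *: e) < ab.2) /\
  (~~ (st_dot ab.1 (z + m *: e) < ab.2) -> ab.2 < st_dot ab.1 (z + s *: e)).
Proof.
move=> gz cc' /andP[cm mc'] /andP[cs sc'] ab abL.
have [ae0|ae0] := eqVneq (st_dot ab.1 e) 0.
  have [|] := gz _ abL; first by rewrite ae0 eqxx.
  rewrite !st_dotDr !st_dotZr ae0 !mulr0 !addr0 => abz; split=> //.
  by rewrite -leNgt lt_neqAle eq_sym abz.
have /cc' : (ab.2 - st_dot ab.1 z) / st_dot ab.1 e \in line_roots L z e.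
  by apply/mapP; exists ab.
have := @line_faceE ab z e m ae0; have := @line_faceE ab z e s ae0.
move: (st_dot ab.1 e) (st_dot ab.1 (z + s *: e)) (st_dot ab.1 (z + m *: e)) (_ / _) ae0
  => b u w r b0 us wm.
rewrite negb_and -!leNgt => /orP rcc.
(* The two values are the same slope times the signed distances to a root that lies on one side of
   both parameters. *)
have uw : 0 < (u - ab.2) * (w - ab.2).
  rewrite us wm mulrACA mulr_gt0//; first by rewrite -expr2 exprn_even_gt0.
  by case: rcc => ?; nra.
rewrite -subr_lt0 -[u < _]subr_lt0 -[_ <= w]subr_ge0 -[_ < u]subr_gt0.
split => w0; first by rewrite -(nmulr_lgt0 _ w0).
rewrite ltNge; apply/negP => u0.
by move: uw; rewrite ltNge mulr_le0_ge0.
Qed.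

End polytopes.

(** * Broken derivatives on a mesh and their integrals along generic lines *)

Section mesh.
Context {R : realType} {d : nat}.
Local Notation X := ('rV[R]_d * R)%type.
Implicit Types (z e : X) (K : set X) (M : set (set X)).

Lemma mbounded_indic (A : set X) : measurable A -> mbounded (\1_A : X -> R).
Proof.
move=> mA; split; first exact: measurable_indic.
by move=> r; exists 1 => z _; rewrite indicE; case: (_ \in _); rewrite ?normr0 ?normr1.
Qed.

(* [U] is the interior for derivatives and the identity for values. *)
Lemma mbounded_patchwork (s : seq (set X)) (U : set X -> set X) (g : X -> R) :
  (forall K, K \in s -> measurable (U K)) ->
  (forall K, K \in s -> exists2 f, mbounded f & forall z, U K z -> g z = f z) ->
  (forall z, (forall K, K \in s -> ~ U K z) -> g z = 0) -> mbounded g.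
Proof.
elim: s g => [|K s IH] g mU gf g0.
  rewrite (_ : g = cst 0); first exact: mbounded_cst.
  by apply/funext => z; exact: g0.
have mUK : measurable (U K) by apply: mU; rewrite mem_head.
have [f mf gfE] := gf K (mem_head _ _).
(* Cutting the remainder to 0 on [U K] lets the induction hypothesis treat it with the other sets
   only. *)
rewrite (_ : g = fun z => f z * \1_(U K) z + g z * \1_(~` U K) z); last first.
  apply/funext => z; rewrite !indicE in_setC; have [zK|zK] := boolP (z \in U K).
    by rewrite mulr1 mulr0 addr0; apply: gfE; rewrite inE in zK.
  by rewrite mulr0 mulr1 add0r.
apply: mboundedD; first by apply: mboundedM => //; exact: mbounded_indic.
apply: IH.
- by move=> K' K's; apply: mU; rewrite inE K's orbT.
- move=> K' K's; have K's' : K' \in K :: s by rewrite inE K's orbT.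
  have [f' mf' gf'] := gf K' K's'.
  exists (fun z => f' z * \1_(~` U K) z) => [|z /gf'-> //].
  by apply: mboundedM => //; apply: mbounded_indic; exact: measurableC.
- move=> z zs; rewrite indicE; have [zK|zK] := boolP (z \in ~` U K); last by rewrite mulr0.
  rewrite mulr1 g0// => K'; rewrite inE => /predU1P[->|]; last exact: zs.
  by rewrite inE in zK.
Qed.

Lemma measurable_polytope (s : seq (X * R)) :
  measurable [set z | forall ab, ab \in s -> st_dot ab.1 z <= ab.2].
Proof.
elim: s => [|ab s IH]; first by rewrite (_ : [set _ | _] = setT)//; apply/seteqP; split.
rewrite (_ : [set _ | _] = [set z | st_dot ab.1 z <= ab.2] `&`
    [set z | forall ab, ab \in s -> st_dot ab.1 z <= ab.2]); last first.
  apply/seteqP; split=> z /=.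
    move=> h; split; first by apply: h; rewrite mem_head.
    by move=> ab' h'; apply: h; rewrite inE h' orbT.
  by move=> [h h'] ab'; rewrite inE => /predU1P[->|]; [exact: h|exact: h'].
apply: measurableI => //.
rewrite (_ : [set z | _] = st_dot ab.1 @^-1` `]-oo, ab.2]); last first.
  by apply/seteqP; split => z; rewrite /= in_itv.
by rewrite -[X in measurable X]setTI; apply: measurable_st_dot.
Qed.

Definition pieces M (v : X -> R) (q : set X -> mpoly.mpoly d.+1 R) :=
  forall K, M K -> {in K, forall z, v z = mpoly.meval (st_coord z) (q K)}.

Lemma exists_pieces M n (v : X -> R) : piecewise_poly M n v ->
  exists q : set X -> mpoly.mpoly d.+1 R, forall K, M K ->
    (forall m, (n < mpoly.mdeg m)%N -> mpoly.mcoeff m (q K) = 0) /\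
    {in K, forall z, v z = mpoly.meval (st_coord z) (q K)}.
Proof.
move=> vn; have /choice[q qP] : forall K : set X, exists p : mpoly.mpoly d.+1 R,
    M K -> (forall m, (n < mpoly.mdeg m)%N -> mpoly.mcoeff m p = 0) /\
      {in K, forall z, v z = mpoly.meval (st_coord z) p}.
  move=> K; have [MK|nMK] := pselect (M K); last by exists (mpoly.mpolyC d.+1 0).
  by have [p p1 p2] := vn K MK; exists p.
by exists q.
Qed.

Lemma bderiv_in M e v q K z : pieces M v q -> M K -> K° z ->
  bderiv M e v z = 'D_e (fun z => mpoly.meval (st_coord z) (q K)) z.
Proof.
move=> vq MK Kz; rewrite /bderiv ifT; last by rewrite inE; exists K.
apply: near_eq_derive; have : nbhs z K by [].
by apply: filterS => w Kw; apply: vq MK _ _; rewrite inE.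
Qed.

Lemma bderiv_out M e v z : ~ (\bigcup_(K in M) K°) z -> bderiv M e v z = 0.
Proof. by move=> zM; rewrite /bderiv ifF//; apply/negbTE; rewrite notin_setE. Qed.

Lemma mbounded_bderiv M e v q : finite_set M -> pieces M v q -> mbounded (bderiv M e v).
Proof.
move=> /finite_seqP[s Ms] vq; apply: (@mbounded_patchwork s (@interior _)).
- by move=> K _; apply: open_measurable_st; exact: open_interior.
- move=> K Ks; have MK : M K by rewrite Ms.
  exists ('D_e (fun z => mpoly.meval (st_coord z) (q K))).
    by apply: mbounded_derive; exact: line_poly_meval.
  by move=> z; apply: bderiv_in.
- move=> z zs; apply: bderiv_out => -[K MK Kz]; apply: (zs K) => //.
  by rewrite Ms in MK.
Qed.

(** The restriction matters: off the union of the elements nothing is known about [v], not even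
    measurability. *)
Lemma mbounded_pieces M v q : finite_set M -> (forall K, M K -> polytope K) ->
  pieces M v q -> mbounded (v \_ (\bigcup_(K in M) K)).
Proof.
move=> /finite_seqP[s Ms] polyM vq; apply: (@mbounded_patchwork s id).
- move=> K Ks; have MK : M K by rewrite Ms.
  by have [[L ->] _ _] := polyM K MK; exact: measurable_polytope.
- move=> K Ks; have MK : M K by rewrite Ms.
  exists (fun z => mpoly.meval (st_coord z) (q K)).
    by apply: (@mbounded_line_poly _ _ 0); exact: line_poly_meval.
  move=> z Kz; rewrite patchE ifT; last by rewrite inE; exists K.
  by apply: vq MK _ _; rewrite inE.
- move=> z zs; rewrite patchE ifF//; apply/negbTE; rewrite notin_setE => -[K MK Kz].
  by apply: (zs K) => //; rewrite Ms in MK.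
Qed.

Lemma measurable_line z e : measurable_fun setT (fun s : R => z + s *: e).
Proof.
apply/measurable_fun_pairP; split.
  apply: measurable_fun_rV => i.
  rewrite (_ : _ \o _ = fun s => z.1 0 i + s * e.1 0 i).
    by apply: measurable_funD => //; exact: measurable_funM.
  by apply/funext => s; rewrite /rV_coord/= !mxE.
by apply: measurable_funD => //; exact: measurable_funM.
Qed.

Lemma line_in_box z e (a b : R) : exists r, forall s, a <= s <= b -> st_box r (z + s *: e).
Proof.
pose N := `|a| + `|b|.
exists ((\sum_(i < d) (`|z.1 0 i| + N * `|e.1 0 i|)) + (`|z.2| + N * `|e.2|)) =>
  s /andP[as_ sb].
have N0 : 0 <= N by rewrite addr_ge0.
have sN : `|s| <= N.
  rewrite ler_norml /N; apply/andP; split.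
    by have := ler_norm (- a); rewrite normrN; have := normr_ge0 b; lra.
  by have := ler_norm b; have := normr_ge0 a; lra.
have coordb (u w : R) : `|u + s * w| <= `|u| + N * `|w|.
  by apply: le_trans (ler_normD _ _) _; rewrite lerD2l normrM ler_wpM2r.
split=> [i|].
  rewrite /= !mxE; apply: le_trans (coordb _ _) _.
  rewrite (bigD1 i)//= -addrA lerDl !addr_ge0 ?mulr_ge0 ?sumr_ge0// => j _.
  by rewrite addr_ge0 ?mulr_ge0.
apply: le_trans (coordb _ _) _; rewrite lerDr sumr_ge0// => j _.
by rewrite addr_ge0 ?mulr_ge0.
Qed.

Lemma integrable_line (g : X -> R) z e (a b : R) : mbounded g ->
  lebesgue_measure.-integrable `[a, b] (EFin \o (fun s => g (z + s *: e))).
Proof.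
move=> [mg bg]; apply: measurable_bounded_integrable => //.
- by rewrite /= lebesgue_measure_itv/=; case: ifP => _; rewrite ?ltry// -EFinB ltry.
- by apply: measurable_funTS; apply: (measurableT_comp mg); exact: measurable_line.
have [r zr] := line_in_box z e a b; have [B gB] := bg r.
exists B; split; first exact: num_real.
move=> B' BB' s /=; rewrite in_itv/= => sab.
by apply: le_trans (ltW BB'); apply: gB; exact: zr.
Qed.

(** [phi] is a continuous representative of [v] on the line: the extension by 0 for spatial lines,
    [v] itself for time lines. Between consecutive roots the line stays inside one element or misses
    all of them, so [phi^2 / 2] is polynomial there with derivative [v * bderiv M e v]. *)
Lemma Rintegral_line M F L v q e z (phi : R -> R) (a b : R) :
  finite_set M -> mesh_faces M F L -> pieces M v q -> generic_line L z e ->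
  a <= b -> {within `[a, b], continuous phi} ->
  (forall s, a < s < b -> (\bigcup_(K in M) K°) (z + s *: e) -> phi s = v (z + s *: e)) ->
  (forall s, a < s < b -> ~ (\bigcup_(K in M) K) (z + s *: e) -> phi s = 0) ->
  lebesgue_measure.-integrable `[a, b]
    (EFin \o (fun s => v (z + s *: e) * bderiv M e v (z + s *: e))) ->
  \int[lebesgue_measure]_(s in `[a, b]) (v (z + s *: e) * bderiv M e v (z + s *: e)) =
  2^-1 * phi b ^+ 2 - 2^-1 * phi a ^+ 2.
Proof.
move=> finM [_ MF] vq gz ab cphi phiG phiU ig.
apply: (@Rintegral_piecewise_poly _ (line_roots L z e) (fun s => 2^-1 * phi s ^+ 2)) => //.
  apply/subspace_continuousP => x xab; apply: cvgM; first exact: cvg_cst.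
  by under eq_cvg do rewrite expr2; rewrite expr2; apply: cvgM;
    move/subspace_continuousP : cphi; exact.
move=> c c' ac cc' c'b cE; pose m := (c + c') / 2.
have cm : c < m < c' by rewrite /m; apply/andP; split; lra.
have sign := generic_line_sign gz cE cm.
have sab s : c < s < c' -> a < s < b.
  by move=> /andP[cs sc']; rewrite (le_lt_trans ac)//= (lt_le_trans sc').
(* The midpoint decides for the whole interval: if it is strictly inside all faces of some [K], so
   is every point; if not, each [K] has a face that is strictly violated throughout. *)
have [[K MK Km]|nK] := pselect (exists2 K, M K & forall ab, ab \in F K -> st_dot ab.1 (z
  + m *: e) < ab.2).
  have [FL KE] := MF K MK.
  have Ks s : c < s < c' -> K° (z + s *: e).
    move=> cs; rewrite KE; apply: interior_faces => ab' ab'F.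
    by apply: (sign s cs _ (FL _ ab'F)).1; exact: Km.
  have [p pE _] := line_poly_meval e (q K).
  exists (2^-1 *: (p z * p z)) => s cs.
  have vE : v (z + s *: e) = (p z).[s].
    by rewrite -pE; apply: vq MK _ _; rewrite inE; apply: interior_subset; exact: Ks.
  rewrite hornerZ hornerM -vE -expr2 phiG//; [|exact: sab|by exists K => //; exact: Ks].
  split=> //; rewrite (bderiv_in _ vq MK (Ks s cs)) (derive_lineS _ (pE z)).
  by rewrite vE derivZ derivM hornerZ hornerD !hornerM; field.
have Us s : c < s < c' -> ~ (\bigcup_(K in M) K) (z + s *: e).
  move=> cs [K MK Ks]; have [FL KE] := MF K MK; apply: nK; exists K => // ab' ab'F.
  apply/negPn/negP => abm; have := (sign s cs _ (FL _ ab'F)).2 abm.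
  by rewrite KE in Ks; have := Ks _ ab'F; rewrite leNgt => /negP.
exists 0 => s cs; rewrite deriv0 !horner0 phiU; [|exact: sab|exact: Us].
rewrite expr0n mulr0; split=> //; rewrite bderiv_out ?mulr0// =>
  -[K MK /interior_subset Ks].
by apply: (Us s cs); exists K.
Qed.

End mesh.

(** * Integration by parts on the cylinder *)

Section cylinder_integrals.
Context {R : realType} {d : nat}.
Local Notation X := ('rV[R]_d * R)%type.
Variables (Os : set 'rV[R]_d) (T : R).
Hypotheses (Os_open : open Os) (Os_bounded : bounded_set Os) (T_gt0 : 0 < T).
Local Notation Om := (cylinder Os T).
Local Notation mu := (lebesgue_rV R d).
Local Notation lam := (@lebesgue_measure R).

Lemma open_cylinder : open Om.
Proof.
rewrite openE => -[x t] [/= Ox tT]; exists (Os, `]0, T[%classic) => //=.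
split; first exact: open_nbhs_nbhs.
by apply: open_nbhs_nbhs; split => //; exact: itv_open.
Qed.

Lemma measurable_cylinder : measurable Om.
Proof. exact: open_measurable_st open_cylinder. Qed.

Lemma measurable_cylinder_base : measurable Os.
Proof.
have := measurable_ysection (T / 2) measurable_cylinder.
rewrite (_ : ysection _ _ = Os)//; apply/seteqP; split=> x; rewrite /ysection/= inE.
  by move=> [].
by move=> Ox; split=> //=; rewrite in_itv/=; apply/andP; split; have := T_gt0; lra.
Qed.

Lemma cylinder_in_box : exists2 r, (forall z, Om z -> st_box r z) & (0 < r /\ forall x i,
  Os x -> `|x 0 i| <= r).
Proof.
have [B [_ OB]] := Os_bounded; pose r : R := `|B| + 1 + T.
have OsB x i : Os x -> `|x 0 i| <= r.
  move=> Ox; apply: le_trans (coord_le_norm x i) _.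
  apply: le_trans (OB (`|B| + 1) _ x Ox) _.
    by rewrite (le_lt_trans (ler_norm B))// ltrDl.
  by rewrite /r lerDl ltW.
exists r; last by split=> //; rewrite /r -addrA ltr_wpDl// addr_gt0.
move=> -[x t] [/= Ox]; rewrite in_itv/= => /andP[t0 tT].
split => [i|/=]; first exact: OsB.
by rewrite ger0_norm ?(ltW t0)// /r; apply: le_trans (ltW tT) _; rewrite lerDr addr_ge0.
Qed.

Lemma cylinder_base_fin : (mu Os < +oo)%E.
Proof. exact: lebesgue_rV_bounded_fin measurable_cylinder_base Os_bounded. Qed.

Lemma itv0T_fin : (lam (`]0%R, T[ : set R) < +oo)%E.
Proof. by rewrite lebesgue_measure_itv/=; case: ifP => _; rewrite ?ltry// -EFinB ltry. Qed.

Lemma cylinder_fin : (st_lebesgue Om < +oo)%E.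
Proof.
rewrite /st_lebesgue /cylinder product_measure1E//; last exact: measurable_cylinder_base.
have := cylinder_base_fin; have := itv0T_fin => h1 h2.
by apply: lte_mul_pinfty; rewrite ?ge0_fin_numE.
Qed.

Lemma mbounded_integrable (f : X -> R) : mbounded f ->
  st_lebesgue.-integrable Om (EFin \o f).
Proof.
move=> [mf bf]; apply: measurable_bounded_integrable.
- exact: measurable_cylinder.
- exact: cylinder_fin.
- exact: measurable_funTS.
have [r Omr _] := cylinder_in_box; have [B fB] := bf r.
exists B; split; first exact: num_real.
by move=> B' BB' z /Omr /fB h; exact: le_trans (ltW BB').
Qed.

Lemma mbounded_integrable_slice (f : X -> R) t : mbounded f -> 
  mu.-integrable Os (EFin \o (fun x => f (x, t))).
Proof.
move=> [mf bf]; apply: measurable_bounded_integrable.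
- exact: measurable_cylinder_base.
- exact: cylinder_base_fin.
- by apply: measurable_funTS; exact: measurableT_comp.
have [r _ [_ Or]] := cylinder_in_box; have [B fB] := bf (`|r| + `|t|).
exists B; split; first exact: num_real.
move=> B' BB' x Ox; apply: le_trans (ltW BB'); apply: fB; split=> [i|] /=.
  by apply: le_trans (Or _ i Ox) _; rewrite (le_trans (ler_norm r))// lerDl.
by rewrite lerDr.
Qed.

Lemma mbounded_integrable_time (f : X -> R) x (a b : R) : mbounded f ->
  lam.-integrable `[a, b] (EFin \o (fun t => f (x, t))).
Proof.
move=> mf; have := @integrable_line R d f (x, 0) time_dir a b mf.
rewrite (_ : (fun s => _) = fun t => f (x, t))//; apply/funext => s.
by congr f; rewrite /time_dir; apply/pair_equal_spec; split;
  rewrite /= ?scaler0 ?addr0// add0r [_ *: _]mulr1.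
Qed.

Lemma integrable_patch_cylinder (f : X -> R) : mbounded f ->
  (mu \x lam)%E.-integrable setT (EFin \o (f \_ Om)).
Proof.
(* The cast is needed: [R] and [measurableTypeR R] carry distinct measurable
   structures, and [st_lebesgue] lives on the latter. *)
move=> mf; have mC : measurable (Om : set ('rV[R]_d * measurableTypeR R)).
  exact: measurable_cylinder.
have /(integrable_mkcond _ mC) := mbounded_integrable mf.
by rewrite restrict_EFin.
Qed.

Lemma Rintegral_cylinder (f : X -> R) : mbounded f ->
  \int[st_lebesgue]_(z in Om) f z =
  \int[lam]_(t in `]0, T[) \int[mu]_(x in Os) f (x, t).
Proof.
move=> mf; rewrite Rintegral_mkcond /Rintegral; congr fine.
rewrite -(integral21_prod_meas1 (integrable_patch_cylinder mf)) /fubini_G/=.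
rewrite [RHS]integral_mkcond; apply: eq_integral => t _; rewrite patchE.
case: ifPn => [tT|/negP tT].
  rewrite fineK; last first.
    apply: integrable_fin_num; first exact: measurable_cylinder_base.
    exact: mbounded_integrable_slice.
  rewrite [RHS]integral_mkcond; apply: eq_integral => x _.
  rewrite !patchE; have [xO|xO] := boolP (x \in Os).
    by rewrite ifT//; apply/mem_set; split; [exact: set_mem xO|exact: set_mem tT].
  by rewrite ifF//; apply/negbTE; move: xO; rewrite !notin_setE => xO [].
apply: integral0_eq => x _; rewrite patchE ifF//; apply/negbTE; rewrite notin_setE =>
  -[_ tT'].
by apply: tT; rewrite inE.
Qed.

(** Space derivatives are integrated at fixed time, the time derivative at a fixed point of the
    base; hence the second order of integration. *)
Lemma Rintegral_cylinder_swap (f : X -> R) : mbounded f ->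
  \int[st_lebesgue]_(z in Om) f z =
  \int[mu]_(x in Os) \int[lam]_(t in `]0, T[) f (x, t).
Proof.
move=> mf; rewrite Rintegral_mkcond /Rintegral; congr fine.
rewrite -(integral12_prod_meas1 (integrable_patch_cylinder mf)) /fubini_F/=.
rewrite [RHS]integral_mkcond; apply: eq_integral => x _; rewrite patchE.
case: ifPn => [xO|/negP xO].
  rewrite fineK; last first.
    apply: integrable_fin_num => //.
    apply: integrableS (mbounded_integrable_time x 0 T mf) => //.
    by apply: subset_itv_oo_cc.
  rewrite [RHS]integral_mkcond; apply: eq_integral => t _.
  rewrite !patchE; have [tT|tT] := boolP (t \in `]0, T[%classic).
    by rewrite ifT//; apply/mem_set; split; [exact: set_mem xO|exact: set_mem tT].
  by rewrite ifF//; apply/negbTE; move: tT; rewrite !notin_setE => tT [].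
apply: integral0_eq => t _; rewrite patchE ifF//; apply/negbTE; rewrite notin_setE =>
  -[xO' _].
by apply: xO; rewrite inE.
Qed.

End cylinder_integrals.

(** * The null set of exceptional lines *)

Section nongeneric.
Context {R : realType} {d : nat}.
Local Notation X := ('rV[R]_d * R)%type.
Implicit Types (z e : X) (L : seq (X * R)).

(** Only the faces parallel to [e] count, so this is a finite union of hyperplanes that are
    themselves unions of lines of direction [e]: such a line lies in it entirely or not at all. *)
Definition nongeneric L e : set X :=
  [set z | exists2 ab, ab \in L & st_dot ab.1 e = 0 /\ st_dot ab.1 z = ab.2].

Lemma generic_lineP L z e : generic_line L z e <-> ~ nongeneric L e z.
Proof.
split=> [gz [ab abL [/eqP abe /eqP abz]]|nz ab abL].
  by have [|] := gz ab abL; rewrite ?abe ?abz.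
have [abe|] := eqVneq (st_dot ab.1 e) 0; last by left.
by right; apply/eqP => abz; apply: nz; exists ab.
Qed.

Lemma nongeneric_line L z e s : nongeneric L e (z + s *: e) <-> nongeneric L e z.
Proof.
by split=> -[ab abL [ae az]]; exists ab => //; split=> //;
  move: az; rewrite st_dotDr st_dotZr ae mulr0 addr0.
Qed.

Lemma nongeneric_cons ab L e : nongeneric (ab :: L) e =
  (if st_dot ab.1 e == 0 then [set z | st_dot ab.1 z = ab.2] else set0) `|` nongeneric L e.
Proof.
apply/seteqP; split=> z.
  move=> [ab']; rewrite inE => /predU1P[->|ab'L] [abe abz].
    by left; rewrite abe eqxx.
  by right; exists ab'.
move=> [|[ab' ab'L h]]; last by exists ab' => //; rewrite inE ab'L orbT.
by case: eqP => // abe abz; exists ab; rewrite ?mem_head.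
Qed.

Lemma nongeneric_nil e : nongeneric [::] e = set0.
Proof. by apply/seteqP; split=> z // -[]. Qed.

Lemma measurable_nongeneric L e : measurable (nongeneric L e).
Proof.
elim: L => [|ab L IH]; first by rewrite nongeneric_nil.
rewrite nongeneric_cons; apply: measurableU => //.
by case: ifP => _ //; exact: measurable_st_hyperplane.
Qed.

Lemma st_lebesgue_nongeneric L e : (forall ab, ab \in L -> ab.1 != 0) ->
  st_lebesgue (nongeneric L e) = 0%E.
Proof.
elim: L => [|ab L IH] L0; first by rewrite nongeneric_nil; exact: measure0.
rewrite nongeneric_cons; set A := if _ then _ else _.
have mA : measurable A by rewrite /A; case: ifP => _ //; exact: measurable_st_hyperplane.
transitivity (st_lebesgue A).
  apply: measureU0 => //; first exact: measurable_nongeneric.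
  by apply: IH => ab' ab'L; apply: L0; rewrite inE ab'L orbT.
rewrite /A; case: ifP => _; last exact: measure0.
by apply: st_lebesgue_hyperplane; apply: L0; rewrite mem_head.
Qed.

(** A face parallel to the time axis has a normal without time component. Its spatial part is
    therefore nonzero, and the trace at time 0 is a hyperplane of space. *)
Lemma lebesgue_rV_nongeneric L : (forall ab, ab \in L -> ab.1 != 0) ->
  lebesgue_rV R d [set x | nongeneric L time_dir (x, 0)] = 0%E.
Proof.
elim: L => [|ab L IH] L0.
  by rewrite nongeneric_nil (_ : [set _ | _] = set0)// measure0.
rewrite nongeneric_cons.
have mN (s : seq (X * R)) : measurable [set x | nongeneric s time_dir (x, 0)].
  have := measurable_ysection (0 : R) (measurable_nongeneric s time_dir).
  by rewrite (_ : ysection _ _ = [set x | nongeneric s time_dir (x, 0)])//;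
    apply/seteqP; split=> x; rewrite /ysection/= inE.
have mH : measurable [set x | st_dot ab.1 (x, 0) = ab.2].
  have := measurable_ysection (0 : R) (measurable_st_hyperplane ab.1 ab.2).
  by rewrite (_ : ysection _ _ = [set x | st_dot ab.1 (x, 0) = ab.2])//;
    apply/seteqP; split=> x; rewrite /ysection/= inE.
rewrite (_ : [set x | _] = (if st_dot ab.1 time_dir == 0 then [set x | st_dot ab.1 (x, 0)
  = ab.2] else set0)
   `|` [set x | nongeneric L time_dir (x, 0)]); last first.
  by case: ifP => _; apply/seteqP; split=> x [h|h]; first [left; exact: h|right; exact: h].
rewrite measureU0 => //; [|by case: ifP|].
  case: ifP => [/eqP abe|_]; last by rewrite measure0.
  have a2 : ab.1.2 = 0.
    move: abe; rewrite st_dotE /= mulr1 /rV_dot big1 ?add0r// => i _.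
    by rewrite mxE mulr0.
  have a1 : ab.1.1 != 0.
    have := L0 ab (mem_head _ _); apply: contra_neq => a1.
    by rewrite [ab.1]surjective_pairing a1 a2.
  rewrite -[RHS](@lebesgue_rV_hyperplane R d ab.1.1 ab.2 a1); congr (lebesgue_rV R d _).
  by apply/seteqP; split => x /=; rewrite st_dotE a2 mul0r addr0.
by apply: IH => ab' ab'L; apply: L0; rewrite inE ab'L orbT.
Qed.

End nongeneric.

(** An indicator factor is used instead of a set difference so that the domain stays a product,
    ready for Fubini. *)
Lemma Rintegral_patch_null d (T : measurableType d) (R : realType)
    (mu : {measure set T -> \bar R}) (D N : set T) (f : T -> R) :
  measurable D -> measurable N -> mu N = 0%E ->
  mu.-integrable D (EFin \o f) ->
  \int[mu]_(x in D) f x = \int[mu]_(x in D) (f x * \1_(~` N) x).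
Proof.
move=> mD mN N0 fi; rewrite {1}/Rintegral (negligible_integral mN mD fi N0).
rewrite -/(Rintegral mu (D `\` N) f) setDE Rintegral_mkcondr.
apply: eq_Rintegral => x _; rewrite patchE indicE.
by case: ifPn => _; rewrite ?mulr1// mulr0.
Qed.

Lemma closure_setX (T1 T2 : topologicalType) (A : set T1) (B : set T2) x y :
  closure A x -> closure B y -> closure (A `*` B) (x, y).
Proof.
move=> Ax By C [[C1 C2] /= [C1x C2y] C12].
have [x' [Ax' Cx']] := Ax _ C1x; have [y' [By' Cy']] := By _ C2y.
by exists (x', y'); split => //; exact: C12.
Qed.

(** * Integrals of [v] times its broken derivatives over the cylinder *)

Section energy_identity.
Context {R : realType} {d : nat}.
Local Notation X := ('rV[R]_d * R)%type.
Variables (Os : set 'rV[R]_d) (T : R) (M : set (set X)) (v : X -> R)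
  (q : set X -> mpoly.mpoly d.+1 R).
Hypotheses (Os_open : open Os) (Os_bounded : bounded_set Os) (T_gt0 : 0 < T)
  (tess : tessellation (cylinder Os T) M) (vE : C0_H1E Os T v) (vq : pieces M v q).
Local Notation Om := (cylinder Os T).
Local Notation mu := (lebesgue_rV R d).
Local Notation lam := (@lebesgue_measure R).
Local Notation G := (\bigcup_(K in M) K°).
Local Notation U := (\bigcup_(K in M) K).

Let finM : finite_set M. Proof. by case: tess. Qed.
Let polyM K : M K -> polytope K. Proof. by case: tess => _ h _ _ /h[]. Qed.
Let UE : U = closure Om. Proof. by case: tess. Qed.
Let Om_sub_U : Om `<=` U. Proof. by rewrite UE; exact: subset_closure. Qed.
Let G_sub_Om : G `<=` Om.
Proof. by case: tess => _ h _ _ z [K /h[_ KO] Kz]; exact: KO. Qed.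
Let G_sub_U : G `<=` U. Proof. exact: subset_trans G_sub_Om Om_sub_U. Qed.

Let D e := bderiv M e v.
Let mbD e : mbounded (D e). Proof. exact: mbounded_bderiv vq. Qed.
Let mbv : mbounded (v \_ U).
Proof. exact: mbounded_pieces vq. Qed.

Lemma mul_bderivE e z : v z * D e z = (v \_ U) z * D e z.
Proof.
have [Gz|Gz] := pselect (G z); last by rewrite /D bderiv_out// !mulr0.
by rewrite patchE ifT// inE; exact: G_sub_U.
Qed.

Lemma mbounded_mul_bderiv e : mbounded (fun z => v z * D e z).
Proof. by under eq_fun do rewrite mul_bderivE; exact: mboundedM. Qed.

(** Off the closure of [Os] the extension is locally 0. On the closure its value is that of [v],
    which is 0 on the boundary by the lateral condition; nearby values are then either values of
    [v], close by continuity up to the boundary, or 0. *)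
Lemma continuous_slice t : 0 < t < T -> continuous (fun y => (v \_ Om) (y, t)).
Proof.
move=> tT; have [_ /subspace_continuousP cv lat _] := vE.
have OmE y : (y, t) \in Om = (y \in Os).
  apply/idP/idP; rewrite !inE; first by case.
  by split=> //; rewrite /= in_itv.
move=> y; have [Oy|Oy] := pselect (closure Os y); last first.
  have : nbhs y (~` closure Os).
    by apply: open_nbhs_nbhs; split=> //; apply: closed_openC; exact: closed_closure.
  move=> nO; apply/(@cvgrPdist_lt _ _ _ (nbhs y) (nbhs_filter y)) => eps e0.
  have y0 : (v \_ Om) (y, t) = 0.
    rewrite patchE OmE ifF//; apply/negbTE; rewrite notin_setE => /subset_closure;
      exact: Oy.
  rewrite y0; apply: filterS nO => y' Oy' /=; rewrite patchE OmE ifF ?subrr ?normr0//.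
  by apply/negbTE; rewrite notin_setE => /subset_closure; exact: Oy'.
have cOm : closure Om (y, t).
  by apply: closure_setX => //; apply: subset_closure; rewrite /= in_itv.
have vy : (v \_ Om) (y, t) = v (y, t).
  rewrite patchE OmE; case: ifPn => //; rewrite notin_setE => nOy.
  apply/esym/lat => //; split=> //.
  by move=> /interior_subset.
apply/(@cvgrPdist_lt _ _ _ (nbhs y) (nbhs_filter y)) => eps e0; rewrite vy.
have := cv (y, t) cOm; move/cvgrPdist_lt => /(_ _ e0); rewrite /prop_near1 /within/= => nv.
have ny : \forall y' \near y, closure Om (y', t) -> `|v (y, t) - v (y', t)| < eps.
  case: nv => [[B1 B2] /= [B1y B2t] B12]; apply: filterS B1y => y' By'.
  by apply: (B12 (y', t)); split=> //=; exact: nbhs_singleton.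
(* Openness of [Os] ensures that a nearby point outside [Os] occurs only when [y] itself is outside,
   where the limit value is 0. *)
have nO : \forall y' \near y, Os y -> Os y'.
  have [Oy'|nOy] := pselect (Os y); last exact: filterE.
  by apply: filterS (open_nbhs_nbhs (conj Os_open Oy')).
apply: filterS2 ny nO => y' h1 h2; rewrite patchE OmE; case: ifPn => Oy'.
  apply: h1; apply: subset_closure; split; first by rewrite inE in Oy'.
  by rewrite /= in_itv.
rewrite subr0 -vy patchE OmE ifF ?normr0//; apply/negbTE.
by move: Oy'; rewrite !notin_setE => nOy' /h2.
Qed.


Let I f := \int[st_lebesgue]_(z in Om) f z.

Lemma Rintegral_generic F L e (f : X -> R) : mesh_faces M F L -> mbounded f ->
  \int[st_lebesgue]_(z in Om) f z =
  \int[st_lebesgue]_(z in Om) (f z * \1_(~` nongeneric L e) z).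
Proof.
move=> [L0 _] mf; apply: Rintegral_patch_null.
- exact: measurable_cylinder.
- exact: measurable_nongeneric.
- exact: st_lebesgue_nongeneric.
- exact: mbounded_integrable.
Qed.

Lemma mbounded_generic L e (f : X -> R) : mbounded f ->
  mbounded (fun z => f z * \1_(~` nongeneric L e) z).
Proof.
move=> mf; apply: mboundedM => //; apply: mbounded_indic.
by apply: measurableC; exact: measurable_nongeneric.
Qed.

Lemma Rintegral_space_line F L i x t : mesh_faces M F L -> 0 < t < T ->
  generic_line L (x, t) (space_dir i) ->
  (\int[lam]_s (v ((x, t) + s *: space_dir i) * D (space_dir i) ((x, t) + s *: space_dir
    i))%:E = 0)%E.
Proof.
move=> FL tT gz; set e := space_dir i; set z := (x, t).
have [r _ [r0 Or]] := cylinder_in_box Os_bounded T_gt0.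
(* A shift of length at least [rho] pushes coordinate [i] beyond the bound [r] valid on [Os]: both
   ends of the segment, and everything past them, lie outside the cylinder. *)
pose rho := r + `|x 0 i| + 1.
have rho0 : 0 < rho by rewrite /rho addr_gt0// ltr_wpDr.
have zE s : z + s *: e = (x + s *: delta_mx 0 i, t).
  by rewrite /z /e /space_dir; apply/pair_equal_spec; split; rewrite //= scaler0 addr0.
have out s : rho <= `|s| -> ~ Om (z + s *: e).
  rewrite zE => rs [/= Ox _]; have := Or _ i Ox; rewrite !mxE !eqxx mulr1.
  apply/negP; rewrite -ltNge; have := lerB_dist s (- x 0 i).
  rewrite opprK normrN addrC [s + _]addrC.
  by move: rs; rewrite /rho; lra.
have ig : lam.-integrable `[-rho, rho] (EFin \o (fun s =>
  v (z + s *: e) * D e (z + s *: e))).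
  exact: integrable_line (mbounded_mul_bderiv e).
have cphi : continuous (fun s : R => (v \_ Om) (z + s *: e)).
  have -> : (fun s : R => (v \_ Om) (z + s *: e)) =
      (fun y => (v \_ Om) (y, t)) \o (fun s : R => x + s *: delta_mx 0 i).
    by apply/funext => s; rewrite /= zE.
  move=> s; apply: continuous_comp; last exact: continuous_slice.
  apply: cvgD; first exact: cvg_cst.
  exact: scalel_continuous.
have fin : (\int[lam]_(s in `[(- rho)%R, rho]) (v (z + s *: e) * D e (z + s *: e))%:E =
  0)%E.
  rewrite -[LHS]fineK; last exact: integrable_fin_num.
  rewrite -[X in X%:E]/(\int[lam]_(s in `[-rho, rho]) (v (z + s *: e) * D e (z + s *: e))).
  rewrite (@Rintegral_line _ _ M F L v q e z (fun s => (v \_ Om) (z + s *: e)))//.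
  - rewrite !patchE !ifF ?expr0n/= ?mulr0 ?subrr//; apply/negbTE; rewrite notin_setE;
    apply: out.
      by rewrite normrN ger0_norm// ltW.
    by rewrite ger0_norm// ltW.
  - by rewrite ltW// (lt_trans _ rho0)// oppr_lt0.
  - exact: continuous_subspaceT.
  - move=> s _ Gz; rewrite patchE ifT// inE; exact: G_sub_Om.
  - move=> s _ Uz; rewrite patchE ifF//; apply/negbTE; rewrite notin_setE => /Om_sub_U;
    exact: Uz.
rewrite -[RHS]fin [RHS]integral_mkcond; apply: eq_integral => s _.
rewrite patchE; case: ifPn => //; rewrite notin_setE/= in_itv/= -ler_norml => /negP.
rewrite -ltNge => rs; rewrite /D bderiv_out ?mulr0// => /G_sub_Om; apply: out; exact: ltW.
Qed.

Lemma Rintegral_space_bderiv i : I (fun z => v z * D (space_dir i) z) = 0.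
Proof.
have [F [L FL]] := exists_mesh_faces finM polyM.
set e := space_dir i; set f := fun z => v z * D e z.
have mf : mbounded f by exact: mbounded_mul_bderiv.
rewrite /I (Rintegral_generic e FL mf).
set g := fun z => _ * _; have mg : mbounded g by exact: mbounded_generic.
rewrite (Rintegral_cylinder Os_open Os_bounded T_gt0 mg).
transitivity (\int[lam]_(t in `]0, T[) (0 : R)); last by rewrite Rintegral_cst// mul0r.
apply: eq_Rintegral => t; rewrite inE/= in_itv/= => tT.
rewrite Rintegral_mkcond /Rintegral.
suff -> : (\int[mu]_x (((fun x => g (x, t)) \_ Os) x)%:E = 0)%E by [].
have [r _ [r0 Or]] := cylinder_in_box Os_bounded T_gt0.
have [B gB] := mg.2 (r + T).
(* The absolute value keeps the bound valid off [Os], where the patched function is 0, whatever the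
   sign of [B]. *)
apply: (@integral_lines_eq0 R d i _ `|B| r).
- apply/(measurable_restrictT _ (measurable_cylinder_base Os_open T_gt0)).
  by apply: measurable_funTS; apply: (measurableT_comp mg.1).
- move=> x; rewrite patchE; case: ifPn => [|_]; last by rewrite normr0.
  rewrite inE => Ox; apply: le_trans (ler_norm B); apply: gB; split=> [j|] /=.
    by apply: le_trans (Or _ j Ox) _; rewrite lerDl ltW.
  by case/andP: tT => t0 tT; rewrite ger0_norm ?(ltW t0)//; apply: ler_wpDl; exact: ltW.
- move=> x xr; rewrite patchE ifF//; apply/negbTE; rewrite notin_setE => Ox; apply: xr => j.
  exact: Or.
move=> x.
have zE s : (x + s *: delta_mx 0 i, t) = (x, t) + s *: e.
  by rewrite /e /space_dir; apply/pair_equal_spec; split; rewrite //= scaler0 addr0.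
(* On an exceptional line the indicator vanishes identically, so nothing has to be integrated
   there. *)
have [nz|gz] := pselect (nongeneric L e (x, t)).
  apply: integral0_eq => s _; rewrite patchE; case: ifPn => // _.
  rewrite /g zE indicE (_ : _ \in _ = false) ?mulr0//.
  by apply/negbTE; rewrite notin_setE => -[]; apply/nongeneric_line.
have gl : generic_line L (x, t) e by apply/generic_lineP.
rewrite -[RHS](Rintegral_space_line FL tT gl).
apply: eq_integral => s _; congr (_%:E).
have -> : v ((x, t) + s *: e) * D e ((x, t) + s *: e) = g (x + s *: delta_mx 0 i, t).
  rewrite /g zE indicE (_ : _ \in _ = true) ?mulr1//.
  by apply/mem_set => /nongeneric_line.
rewrite patchE; case: ifPn => //; rewrite notin_setE => nO.
rewrite /g /f /D bderiv_out ?mulr0 ?mul0r// => /G_sub_Om[/= Ox _].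
exact: nO.
Qed.


Lemma time_lineE (x : 'rV[R]_d) t : (x, 0) + t *: time_dir = (x, t).
Proof.
rewrite /time_dir; apply/pair_equal_spec; split; rewrite /= ?scaler0 ?addr0//.
by rewrite add0r [_ *: _]mulr1.
Qed.

Lemma closure_cylinder_line x t : Os x -> 0 <= t <= T -> closure Om (x, t).
Proof.
move=> Ox /andP[t0 tT]; apply: closure_setX; first exact: subset_closure.
move=> B /nbhs_ballP[e /= e0 eB].
(* Smaller than [e] and at most [T / 4]: a move of [dl] towards the middle of the time interval
   stays in the ball and lands in the open interval, even from an endpoint. *)
pose dl := Num.min e T / 4.
have dl0 : 0 < dl by rewrite divr_gt0// lt_min e0.
have dle : dl < e.
  have : dl <= e / 4 by rewrite ler_pM2r// ge_min lexx.
  by move=> /le_lt_trans; apply; move: e0; lra.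
have dlT : dl <= T / 4.
  by rewrite ler_pM2r// ge_min lexx orbT.
move: dl dl0 dle dlT => dl dl0 dle dlT.
have [tT2|tT2] := leP t (T / 2).
  exists (t + dl); split; first by rewrite /= in_itv/=; apply/andP; split; move: T_gt0; lra.
  by apply: eB; rewrite /ball/= opprD addNKr normrN gtr0_norm.
exists (t - dl); split; first by rewrite /= in_itv/=; apply/andP; split; move: T_gt0; lra.
by apply: eB; rewrite /ball/= opprB addrCA subrr addr0 gtr0_norm.
Qed.

Lemma continuous_time_line x : Os x -> {within `[0, T], continuous (fun t => v (x, t))}.
Proof.
move=> Ox; have [_ /subspace_continuousP cv _ _] := vE.
apply/subspace_continuousP => t; rewrite /= in_itv/= => tT.
apply/(@cvgrPdist_lt _ _ _ (within `[0, T] (nbhs t)) _) => eps e0.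
have := cv (x, t) (closure_cylinder_line Ox tT); move/cvgrPdist_lt => /(_ _ e0).
rewrite /prop_near1 /within/= => -[[B1 B2] /= [B1x B2t] B12].
apply: filterS B2t => t' Bt'; rewrite in_itv/= => tT'.
apply: (B12 (x, t')); first by split=> //=; exact: nbhs_singleton.
exact: closure_cylinder_line.
Qed.

(** The open segment above [x] stays in the cylinder and [v] is continuous up to both of its ends,
    so [v] serves as its own representative; the initial condition removes the lower end. *)
Lemma Rintegral_time_line F L x : mesh_faces M F L -> Os x ->
  generic_line L (x, 0) time_dir ->
  \int[lam]_(t in `]0, T[) (v (x, t) * D time_dir (x, t)) = 2^-1 * v (x, T) ^+ 2.
Proof.
move=> FL Ox gz; set e := time_dir.
have ig : lam.-integrable `[0, T] (EFin \o (fun t => v (x, t) * D e (x, t))).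
  exact: mbounded_integrable_time (mbounded_mul_bderiv e).
rewrite Rintegral_itv_bndo_bndc; last first.
  by apply: integrableS ig => //; exact: subset_itv_oo_cc.
rewrite Rintegral_itv_obnd_cbnd; last first.
  by apply: integrableS ig => //; apply: subset_itv; rewrite bnd_simp.
have [_ _ _ v0] := vE.
transitivity (2^-1 * v (x, T) ^+ 2 - 2^-1 * v (x, 0) ^+ 2); last first.
  by rewrite v0// expr0n/= mulr0 subr0.
transitivity (\int[lam]_(t in `[0, T])
    (v ((x, 0) + t *: e) * bderiv M e v ((x, 0) + t *: e))).
  by apply: eq_Rintegral => t _; rewrite time_lineE.
apply: (@Rintegral_line _ _ M F L v q e (x, 0) (fun t => v (x, t))) => //.
- exact: ltW.
- exact: continuous_time_line.
- by move=> t _ _; rewrite time_lineE.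
- move=> t tT; rewrite time_lineE => Ut; exfalso; apply: Ut.
  by apply: Om_sub_U; split => //=; rewrite in_itv.
- by rewrite (_ : (fun t => _) = (fun t => v (x, t) * D e (x, t)))//; apply/funext => t;
  rewrite time_lineE.
Qed.

Lemma Rintegral_time_bderiv : I (fun z => v z * D time_dir z) = 2^-1 * sqn Os (slice v T).
Proof.
have [F [L FL]] := exists_mesh_faces finM polyM.
set e := time_dir; set f := fun z => v z * D e z.
have mf : mbounded f by exact: mbounded_mul_bderiv.
rewrite /I (Rintegral_generic e FL mf).
set g := fun z => _ * _; have mg : mbounded g by exact: mbounded_generic.
rewrite (Rintegral_cylinder_swap Os_open Os_bounded T_gt0 mg).
pose N : set 'rV[R]_d := [set x | nongeneric L e (x, 0)].
have mN : measurable N.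
  have := measurable_ysection (0 : R) (measurable_nongeneric L e).
  by rewrite (_ : ysection _ _ = N)//; apply/seteqP; split=> x; rewrite /ysection/= inE.
have mbv2 : mbounded (fun z => 2^-1 * ((v \_ U) z * (v \_ U) z)).
  by apply: mboundedM; [exact: mbounded_cst|exact: mboundedM].
(* Over [N] the inner integral is 0 instead of half the squared final value. The indicator records
   this and is removed afterwards, [N] being null in space. *)
transitivity (\int[mu]_(x in Os) ((2^-1 * ((v \_ U) (x, T) * (v \_ U) (x, T))) * \1_(~`
  N) x)).
  apply: eq_Rintegral => x; rewrite inE => Ox.
  have UT : (x, T) \in U.
    by rewrite UE; apply/mem_set/closure_cylinder_line => //; rewrite lexx ltW.
  have NE t : (x, t) \in ~` nongeneric L e = (x \in ~` N).
    rewrite !in_setC; congr (~~ _); rewrite -(time_lineE x t).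
    by apply/idP/idP; rewrite !inE => /nongeneric_line.
  rewrite indicE; have [xN|xN] := boolP (x \in ~` N); last first.
    rewrite mulr0; transitivity (\int[lam]_(t in `]0, T[) (0 : R));
      last by rewrite Rintegral_cst// mul0r.
    by apply: eq_Rintegral => t _; rewrite /g indicE NE (negbTE xN) mulr0.
  rewrite mulr1 patchE UT -expr2 -(Rintegral_time_line FL)//; last first.
    by apply/generic_lineP; rewrite inE in xN.
  by apply: eq_Rintegral => t _; rewrite /g indicE NE xN mulr1.
have iv2 := mbounded_integrable_slice Os_open Os_bounded T_gt0 T mbv2.
have iv : mu.-integrable Os (EFin \o (fun x => (v \_ U) (x, T) * (v \_ U) (x, T))).
  by apply: (mbounded_integrable_slice Os_open Os_bounded T_gt0 T (f := fun z =>
    (v \_ U) z * (v \_ U) z)); exact: mboundedM.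
have mO := measurable_cylinder_base Os_open T_gt0.
rewrite -(Rintegral_patch_null mO mN _ iv2); last exact: lebesgue_rV_nongeneric FL.1.
rewrite RintegralZl//; congr (_ * _); rewrite /sqn /ip.
apply: eq_Rintegral => x; rewrite inE => Ox; rewrite /slice patchE ifT//.
by rewrite UE; apply/mem_set/closure_cylinder_line => //; rewrite lexx ltW.
Qed.

End energy_identity.

(** * Coercivity *)

Section affine_pieces.
Context {R : realType} {d : nat}.
Local Notation X := ('rV[R]_d * R)%type.
Implicit Types (z e : X) (f : X -> R).

(** The slope does not depend on the base point [z]: the derivative along [e] is then a constant,
    and the second one vanishes. *)
Definition line_affine e f := exists l, forall z s, f (z + s *: e) = f z + s * l.

Lemma line_affine_cst e (a : R) : line_affine e (cst a).
Proof. by exists 0 => z s; rewrite mulr0 addr0. Qed.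

Lemma line_affine_meval e (p : mpoly.mpoly d.+1 R) :
  (forall m, (1 < mpoly.mdeg m)%N -> mpoly.mcoeff m p = 0) ->
  line_affine e (fun z => mpoly.meval (st_coord z) p).
Proof.
move=> p1; under eq_fun do rewrite mpoly.mevalE.
elim: (mpoly.msupp p : seq _) => [|m s [l lE]].
  by under eq_fun do rewrite big_nil; exact: line_affine_cst.
under eq_fun do rewrite big_cons.
suff [l' l'E] : line_affine e (fun z =>
  mpoly.mcoeff m p * \prod_i st_coord z i ^+ mpoly.fun_of_multinom m i).
  by exists (l' + l) => z s'; rewrite l'E lE mulrDr addrACA.
have [m1|] := ltnP 1 (mpoly.mdeg m).
  by rewrite p1//; exists 0 => z s'; rewrite !mul0r mulr0 addr0.
rewrite leq_eqVlt ltnS leqn0 => /orP[/mpoly.mdeg1P[i /eqP ->]|].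
  exists (mpoly.mcoeff (mpoly.mnm1 i) p * st_coord e i) => z s'.
  rewrite -!mpoly.mevalX !mpoly.mevalXU st_coordD st_coordZ; ring.
rewrite mpoly.mdeg_eq0 => /eqP ->; exists 0 => z s'.
by rewrite mulr0 addr0 -!mpoly.mevalX mpoly.mpolyX0 !mpoly.meval1.
Qed.

Lemma derive_line_affine e f : line_affine e f -> exists l, forall z, 'D_e f z = l.
Proof.
move=> [l lE]; exists l => z; rewrite (@derive_line _ _ f z e ((f z)%:P + l *: 'X)).
  by rewrite derivD derivC add0r derivZ derivX hornerZ hornerC mulr1.
by move=> h; rewrite lE hornerD hornerC hornerZ hornerX mulrC.
Qed.

Lemma bderiv_bderiv_eq0 M v q e : pieces M v q ->
  (forall K, M K -> forall m, (1 < mpoly.mdeg m)%N -> mpoly.mcoeff m (q K) = 0) ->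
  forall z, bderiv M e (bderiv M e v) z = 0.
Proof.
move=> vq q1 z; have [[K MK Kz]|] := pselect ((\bigcup_(K in M) K°) z);
  last exact: bderiv_out.
have [l lE] := derive_line_affine (line_affine_meval e (q1 K MK)).
rewrite {1}/bderiv ifT; last by rewrite inE; exists K.
rewrite (@near_eq_derive _ _ _ _ (cst l)) ?derive_cst//.
have := open_nbhs_nbhs (conj (@open_interior _ K) Kz).
by apply: filterS => w Kw; rewrite (bderiv_in _ vq MK Kw).
Qed.

End affine_pieces.

(** An abstract functional covers both the space-time integral and the spatial integral at a fixed
    time. *)
Lemma mbounded_additive_sum (R : realType) d (Phi : ('rV[R]_d * R -> R) -> R) :
  Phi (cst 0) = 0 ->
  (forall f g, mbounded f -> mbounded g -> Phi (fun z => f z + g z) = Phi f + Phi g) ->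
  forall (I : Type) (s : seq I) F, (forall i, mbounded (F i)) ->
  Phi (fun z => \sum_(i <- s) F i z) = \sum_(i <- s) Phi (F i).
Proof.
move=> Phi0 PhiD I s F mF; elim: s => [|i s IH].
  by rewrite big_nil -[RHS]Phi0; congr Phi; apply/funext => z; rewrite big_nil.
rewrite big_cons -IH -PhiD//; last exact: mbounded_sum.
by congr Phi; apply/funext => z; rewrite big_cons.
Qed.

(** * Assembly of the bilinear form and the energy from space-time integrals *)

Section coercivity.
Context {R : realType} {d : nat}.
Local Notation X := ('rV[R]_d * R)%type.
Variables (Os : set 'rV[R]_d) (T : R) (M : set (set X)) (v : X -> R)
  (q : set X -> mpoly.mpoly d.+1 R) (alpha gamma : R) (beta : 'rV[R]_d).
Hypotheses (Os_open : open Os) (Os_bounded : bounded_set Os) (T_gt0 : 0 < T)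
  (tess : tessellation (cylinder Os T) M) (vE : C0_H1E Os T v) (vq : pieces M v q).
Hypotheses (alpha_ge0 : 0 <= alpha) (gamma_ge0 : 0 <= gamma).
(** Common form of the two alternatives of the theorem: piecewise linear functions annihilate the
    second factor, [alpha = 0] the first. *)
Hypothesis lap0 : forall z, alpha * laplacian M v z = 0.
Local Notation Om := (cylinder Os T).
Local Notation mu := (lebesgue_rV R d).
Local Notation lam := (@lebesgue_measure R).
Local Notation U := (\bigcup_(K in M) K).

Let finM : finite_set M. Proof. by case: tess. Qed.
Let polyM K : M K -> polytope K. Proof. by case: tess => _ h _ _ /h[]. Qed.
Let Om_sub_U : Om `<=` U. Proof. by case: tess => _ _ -> _; exact: subset_closure. Qed.

Let I (f : X -> R) : R := \int[st_lebesgue]_(z in Om) f z.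
Let S (t : R) (f : X -> R) : R := \int[mu]_(x in Os) f (x, t).

Let mO := measurable_cylinder_base Os_open T_gt0.

Let ID f g : mbounded f -> mbounded g -> I (fun z => f z + g z) = I f + I g.
Proof.
by move=> mf mg; apply: RintegralD;
  [exact: measurable_cylinder|exact: mbounded_integrable..].
Qed.

Let IZ a f : mbounded f -> I (fun z => a * f z) = a * I f.
Proof.
by move=> mf; apply: RintegralZl; [exact: measurable_cylinder|exact: mbounded_integrable].
Qed.

Let I0 : I (cst 0) = 0.
Proof. by rewrite /I Rintegral_cst ?mul0r//; exact: measurable_cylinder. Qed.

Let SD t f g : mbounded f -> mbounded g -> S t (fun z => f z + g z) = S t f + S t g.
Proof. by move=> mf mg; apply: RintegralD => //; exact: mbounded_integrable_slice. Qed.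

Let SZ t a f : mbounded f -> S t (fun z => a * f z) = a * S t f.
Proof. by move=> mf; apply: RintegralZl => //; exact: mbounded_integrable_slice. Qed.

Let S0 t : S t (cst 0) = 0.
Proof. by rewrite /S Rintegral_cst// mul0r. Qed.

Let mbD e : mbounded (bderiv M e v). Proof. exact: mbounded_bderiv vq. Qed.

Let w := v \_ U.
Let mbw : mbounded w. Proof. exact: mbounded_pieces vq. Qed.

Let grad2 i z := dx M i v z * dx M i v z.
Let time_part z := v z * dt M v z.
Let conv_part z := convection M beta v z * v z.
Let mass z := w z * w z.
Let stream z := convection M beta v z + dt M v z.
Let stream2 z := stream z * stream z.

Let mbgrad2 i : mbounded (grad2 i).
Proof. exact: (mboundedM (mbD _) (mbD _)). Qed.
Let mbtime : mbounded time_part.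
Proof. exact: (mbounded_mul_bderiv tess vq). Qed.
Let conv_partE z : conv_part z = \sum_(i < d) beta 0 i * (v z * dx M i v z).
Proof. by rewrite /conv_part mulr_suml; apply: eq_bigr => i _;
  rewrite -mulrA [_ * v z]mulrC. Qed.
Let mbvdx i : mbounded (fun z => beta 0 i * (v z * dx M i v z)).
Proof. by apply: mboundedM; [exact: mbounded_cst|exact: (mbounded_mul_bderiv tess vq)]. Qed.
Let mbconv : mbounded conv_part.
Proof. by have := mbounded_sum (index_enum 'I_d) mbvdx; rewrite -(funext conv_partE). Qed.
Let mbmass : mbounded mass. Proof. exact: (mboundedM mbw mbw). Qed.
Let mbstream : mbounded stream.
Proof.
have mc : mbounded (convection M beta v).
  have mF i : mbounded (fun z => beta 0 i * dx M i v z).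
    by apply: mboundedM; [exact: mbounded_cst|exact: mbD].
  exact: (mbounded_sum (index_enum 'I_d) mF).
exact: (mboundedD mc (mbD _)).
Qed.
Let mbstream2 : mbounded stream2. Proof. exact: (mboundedM mbstream mbstream). Qed.

Lemma Rintegral_transport :
  I time_part + I conv_part = 2^-1 * sqn Os (slice v T).
Proof.
have -> : I conv_part = 0.
  rewrite (funext conv_partE) (mbounded_additive_sum I0 ID)// big1// => i _.
  rewrite IZ; last exact: (mbounded_mul_bderiv tess vq).
  by rewrite /I (Rintegral_space_bderiv Os_open Os_bounded T_gt0 tess vE vq) mulr0.
rewrite addr0.
exact: (Rintegral_time_bderiv Os_open Os_bounded T_gt0 tess vE vq).
Qed.


Let mbgrad : mbounded (fun z => \sum_(i < d) grad2 i z).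
Proof. exact: mbounded_sum. Qed.

Let massE x t : Os x -> 0 < t < T -> mass (x, t) = v (x, t) * v (x, t).
Proof.
move=> Ox tT; rewrite /mass /w patchE ifT// inE; apply: Om_sub_U.
by split => //; rewrite /= in_itv.
Qed.

Let bulk z := time_part z + (alpha * (\sum_(i < d) grad2 i z) + (conv_part z + gamma *
  mass z)).

Let mbZ a (f : X -> R) : mbounded f -> mbounded (fun z => a * f z).
Proof. by move=> mf; apply: mboundedM => //; exact: mbounded_cst. Qed.

(** Both sides equal the space-time integral of the single density [bulk]: linearity is applied over
    the cylinder on one side, on each time slice on the other, and Fubini joins them. *)
Lemma B_formE : B_form Os T M alpha beta gamma v v =
  I time_part + alpha * (\sum_(i < d) I (grad2 i)) + I conv_part + gamma * I mass.
Proof.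
have m1 : mbounded (fun z => conv_part z + gamma * mass z).
  exact: (mboundedD mbconv (mbZ gamma mbmass)).
have m2 := mboundedD (mbZ alpha mbgrad) m1; have m3 := mboundedD mbtime m2.
transitivity (I bulk); last first.
  rewrite /bulk (ID mbtime m2) (ID (mbZ alpha mbgrad) m1) (ID mbconv (mbZ gamma mbmass)).
  by rewrite (IZ alpha mbgrad) (IZ gamma mbmass) (mbounded_additive_sum I0 ID)// !addrA.
rewrite /I (Rintegral_cylinder Os_open Os_bounded T_gt0 m3).
apply: eq_Rintegral => t; rewrite inE/= in_itv/= => tT.
rewrite -/(S t bulk) /bulk (SD t mbtime m2) (SD t (mbZ alpha mbgrad) m1) (SD t mbconv
  (mbZ gamma mbmass)).
rewrite (SZ t alpha mbgrad) (SZ t gamma mbmass) (mbounded_additive_sum (S0 t) (@SD t))//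
  !addrA.
congr (_ + _ + _ + gamma * _).
- by apply: eq_Rintegral => x _; rewrite /slice mulrC.
- by apply: eq_Rintegral => x; rewrite inE => Ox; rewrite massE.
Qed.

(** By [lap0], [L_op] applied to [v] is [stream + gamma * v]; its product with [c * stream] is
    [c * stream2] plus [c * gamma] times the transport density [v * stream]. *)
Lemma stabilizationE (c : R) :
  \int[lam]_(t in `]0, T[)
      ip Os (slice (L_op M alpha beta gamma v) t)
            (slice (fun z => c * (convection M beta v z + dt M v z)) t) =
  c * (I stream2 + gamma * (I time_part + I conv_part)).
Proof.
pose f z := c * (stream2 z + gamma * (time_part z + conv_part z)).
have m1 := mboundedD mbtime mbconv.
have m2 := mboundedD mbstream2 (mbZ gamma m1).
transitivity (I f); last first.
  by rewrite /f (IZ c m2) (ID mbstream2 (mbZ gamma m1)) (IZ gamma m1) (ID mbtime mbconv).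
rewrite /I (Rintegral_cylinder Os_open Os_bounded T_gt0 (mbZ c m2)).
apply: eq_Rintegral => t _; apply: eq_Rintegral => x _.
rewrite /slice /L_op lap0 /f /stream2 /stream /time_part /conv_part; ring.
Qed.

Lemma energy_sqE h : energy_sq Os T M alpha beta gamma h 1 v =
  sqn Os (slice v T) + (alpha * (\sum_(i < d) I (grad2 i)) +
    h `^ 1 * nu beta * I stream2 + gamma * I mass).
Proof.
congr (_ + _); set c := h `^ 1 * nu beta.
pose f z := alpha * (\sum_(i < d) grad2 i z) + (c * stream2 z + gamma * mass z).
have m1 := mboundedD (mbZ c mbstream2) (mbZ gamma mbmass).
transitivity (I f); last first.
  rewrite /f (ID (mbZ alpha mbgrad) m1) (ID (mbZ c mbstream2) (mbZ gamma mbmass)).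
  by rewrite (IZ alpha mbgrad) (IZ c mbstream2) (IZ gamma mbmass) (mbounded_additive_sum
    I0 ID)// !addrA.
rewrite /I (Rintegral_cylinder Os_open Os_bounded T_gt0 (mboundedD (mbZ alpha mbgrad) m1)).
apply: eq_Rintegral => t; rewrite inE/= in_itv/= => tT.
rewrite -/(S t f) /f (SD t (mbZ alpha mbgrad) m1) (SD t (mbZ c mbstream2) (mbZ gamma
  mbmass)).
rewrite (SZ t alpha mbgrad) (SZ t c mbstream2) (SZ t gamma mbmass) (mbounded_additive_sum
  (S0 t) (@SD t))// !addrA.
congr (_ + _ + gamma * _).
by apply: eq_Rintegral => x; rewrite inE => Ox; rewrite massE.
Qed.

Lemma B_h_coercive h theta : 0 < theta -> theta < 1 ->
  Num.min theta 2^-1 * energy_sq Os T M alpha beta gamma h 1 v <=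
  B_h Os T M alpha beta gamma h 1 theta v v.
Proof.
move=> th0 th1; rewrite energy_sqE /B_h B_formE stabilizationE.
have := Rintegral_transport.
have I_ge0 f : (forall z, 0 <= f z) -> 0 <= I f by move=> f0; exact: Rintegral_ge0.
have Q0 : 0 <= sqn Os (slice v T) by apply: Rintegral_ge0 => x _; rewrite -expr2 sqr_ge0.
have A0 : 0 <= \sum_(i < d) I (grad2 i).
  by apply: sumr_ge0 => i _; apply: I_ge0 => z; rewrite /grad2 -expr2 sqr_ge0.
have D0 : 0 <= I stream2 by apply: I_ge0 => z; rewrite /stream2 -expr2 sqr_ge0.
have V0 : 0 <= I mass by apply: I_ge0 => z; rewrite /mass -expr2 sqr_ge0.
have k0 : 0 <= h `^ 1 * nu beta by rewrite mulr_ge0 ?powR_ge0// invr_ge0 sqrtr_ge0.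
rewrite -(mulrA theta).
move: (I time_part) (I conv_part) (\sum_(i < d) I (grad2 i)) (I stream2) (I mass)
  (sqn Os (slice v T)) (h `^ 1 * nu beta) A0 D0 V0 Q0 k0.
move=> Ti Co A Dd Ma Q k A0 D0 V0 Q0 k0 TC.
have aA := mulr_ge0 alpha_ge0 A0; have gM := mulr_ge0 gamma_ge0 V0.
have kD := mulr_ge0 k0 D0.
have gQ := mulr_ge0 (mulr_ge0 (ltW th0) k0) (mulr_ge0 gamma_ge0 Q0).
have Cth : Num.min theta 2^-1 <= theta by rewrite ge_min lexx.
have Ch : Num.min theta 2^-1 <= 2^-1 by rewrite ge_min lexx orbT.
move: (Num.min theta 2^-1) Cth Ch => C Cth Ch.
have C1 : C <= 1 by apply: le_trans (ltW th1).
have e1 := ler_wpM2r Q0 Ch; have e2 := ler_wpM2r aA C1.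
have e3 := ler_wpM2r gM C1; have e4 := ler_wpM2r kD Cth.
rewrite TC.
(* Term-by-term comparison. The last summand on the right is the zeroth-order part of the
   stabilization after the transport identity; it is nonnegative and is discarded. *)
suff : C * Q + C * (alpha * A) + C * (k * Dd) + C * (gamma * Ma) <=
  2^-1 * Q + 1 * (alpha * A) + theta * (k * Dd) + 1 * (gamma * Ma) + theta * k * (gamma *
    Q) * 2^-1.
  have -> : Ti + alpha * A + Co = 2^-1 * Q + alpha * A by rewrite addrAC TC.
  by congr (_ <= _); ring.
lra.
Qed.

End coercivity.


Theorem lemma1 (R : realType) (d : nat) (Os : set 'rV[R]_d)
    (T alpha gamma : R) (beta : 'rV[R]_d)
    (H : set R) (Th : R -> set (set ('rV[R]_d * R)))
    (V : R -> set ('rV[R]_d * R -> R)) (k : nat)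
    (d_gt0 : (0 < d)%N)
    (Os_open : open Os) (Os_connected : connected Os) (Os_nonempty : Os !=set0)
    (Os_bounded : bounded_set Os)
    (T_gt0 : 0 < T) (alpha_ge0 : 0 <= alpha) (gamma_ge0 : 0 <= gamma)
    (H_gt0 : forall h, H h -> 0 < h)
    (Th_tess : forall h, H h -> tessellation (cylinder Os T) (Th h))
    (Th_shape : shape_regular H Th) (Th_quasi : quasiuniform H Th)
    (V_fe : forall h, H h -> finite_element_space Os T (Th h) k (V h))
    (hyp : (forall h, H h -> V h = conforming_poly_space Os T (Th h) 1) \/
           alpha = 0) :
  exists2 theta0 : R, 0 < theta0 &
    forall theta : R, 0 < theta -> theta < theta0 ->
      exists2 C : R, 0 < C &
        forall h, H h -> forall v, V h v ->
          C * energy_sq Os T (Th h) alpha beta gamma h 1 v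
          <= B_h Os T (Th h) alpha beta gamma h 1 theta v v.
Proof.
exists 1 => // theta th0 th1; exists (Num.min theta 2^-1).
  by rewrite lt_min th0 invr_gt0 ltr0n.
move=> h Hh v Vv; have [Vsub _ _] := V_fe h Hh.
have [vE vk] := Vsub v Vv.
have [q [vq lap0]] : exists q, pieces (Th h) v q /\
    forall z, alpha * laplacian (Th h) v z = 0.
  case: hyp => [V1|->].
    (* The pieces must come from the degree 1 description of [V h]: those given by the ambient
       degree [k] carry no bound by 1 on their degree. *)
    have [_ /exists_pieces[q qP]] : conforming_poly_space Os T (Th h) 1 v by rewrite -V1.
    have vq : pieces (Th h) v q by move=> K /qP[].
    exists q; split=> // z; rewrite /laplacian big1 ?mulr0// => i _.
    by apply: (bderiv_bderiv_eq0 _ vq) => K /qP[].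
  have [q qP] := exists_pieces vk; exists q; split => [K /qP[] //|z].
  by rewrite mul0r.
exact: (B_h_coercive beta Os_open Os_bounded T_gt0 (Th_tess h Hh) vE vq alpha_ge0
  gamma_ge0 lap0 h th0 th1).
Qed.
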